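(* Let $A$ be a finite abelian group. With the symmetry $c^\omega_{U,W}(\xi\otimes\eta)=\omega_A(w,v)\,\eta\otimes\xi$ (for $\xi\in U_v$, $\eta\in W_w$) on $\mathrm{Rep}(\mathrm{ASp}(A))$, the functor $$\mathcal{F}:\mathrm{Rep}^\omega(\mathrm{ASp}(A))\to\mathrm{Rep}(C(A)),$$ with its tensor structure $J$, is an isomorphism of symmetric tensor categories, where $\mathrm{Rep}(C(A))$ carries its ordinary symmetry (the flip).
   Context: **Setting.** $A$ is a finite abelian group, written additively; $\widehat{A}=\mathrm{Hom}(A,U(1))$ is its character group; $V_A=A\oplus\widehat{A}$ (written additively); $\widehat{V_A}=\mathrm{Hom}(V_A,U(1))$. Put $\beta_A((a,\chi),(b,\psi))=\chi(b)$ and $\omega_A(u,v)=\beta_A(u,v)\beta_A(v,u)^{-1}$. Then $\mathrm{Sp}(V_A)=\{T\in\mathrm{Aut}(V_A):\omega_A(Tu,Tv)=\omega_A(u,v)\ \forall u,v\in V_A\}$. **Projective Clifford group.** Let $\mathcal{H}=\mathbb{C}[A]$ with orthonormal basis $|b\rangle$, $b\in A$; for $v=(a,\chi)\in V_A$ let $W_v|b\rangle=\chi(b)|a+b\rangle$; $H(A)=\{zW_v:z\in U(1),v\in V_A\}$ and $C(A)=N_{U(\mathcal{H})}(H(A))/(U(1)\cdot I)$. Throughout, $C(A)$ is identified (by a known isomorphism) with the group of pairs $(T,\lambda)$, $T\in\mathrm{Aut}(V_A)$, $\lambda:V_A\to U(1)$ a function, satisfying $\lambda(u+v)\lambda(u)^{-1}\lambda(v)^{-1}=\beta_A(Tu,Tv)\beta_A(u,v)^{-1}$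 for all $u,v$, with product $(T,\lambda)(S,\mu)=(TS,\lambda^S\mu)$, $\lambda^S(u)=\lambda(Su)$; the pair $(T,\lambda)$ corresponds to the class of any unitary $U$ with $UW_uU^\dagger=\lambda(u)W_{Tu}$ for all $u$. Necessarily $T\in\mathrm{Sp}(V_A)$ and $\lambda(0)=1$, and the projection to $\mathrm{Sp}(V_A)$ is onto (known). **Affine symplectic group.** $\mathrm{ASp}(A)=\{(T,\chi):T\in\mathrm{Sp}(V_A),\chi\in\widehat{V_A}\}$ with $(T,\chi)(S,\psi)=(TS,\chi^S\psi)$, $\chi^S(v)=\chi(Sv)$. **The functor $\mathcal{F}$.** $\mathrm{Rep}(G)$ is the category of finite-dimensional complex representations. For a representation $(U,\pi)$ of $\mathrm{ASp}(A)$ put $U_v=\{\xi\in U:\pi(\mathrm{id},\chi)\xi=\chi(v)\xi\ \forall\chi\in\widehat{V_A}\}$ for $v\in V_A$ and $\rho(T)=\pi(T,1)$; then $U=\bigoplus_{v\in V_A}U_v$ and $\rho(T)U_v\subseteq U_{Tv}$. $\mathcal{F}(U)$ is the same vector space with $C(A)$-action $(T,\lambda)\cdot\xi=\lambda(v)\rho(T)\xi$ for $\xi\in U_v$; $\mathcal{F}$ is the identity on morphisms. Its tensor structure is $J_{U,W}:\mathcal{F}(U)\otimes\mathcal{F}(W)\to\mathcal{F}(U\otimes W)$, $J_{U,W}(\xi\otimes\eta)=\beta_A(v,w)\,\xi\otimes\eta$ for $\xi\in U_v$, $\eta\in W_w$, with identity unit map. $\mathrm{Rep}^\omega(\mathrm{ASp}(A))$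 denotes the tensor category $\mathrm{Rep}(\mathrm{ASp}(A))$ with the symmetry $c^\omega$ in place of the flip. An isomorphism of (symmetric) tensor categories is a (symmetric) tensor functor with an inverse (symmetric) tensor functor, composites being strictly the identity tensor functors. *)

(* Defs.v *)
From HB Require Import structures.
From mathcomp Require Import all_boot all_order all_fingroup all_algebra.
From mathcomp Require Import boolp.
From mathcomp Require Import ring.
From mathcomp Require Import separable cyclotomic.

Set Implicit Arguments.
Unset Strict Implicit.
Unset Printing Implicit Defensive.

Import Order.TTheory GRing.Theory Num.Theory.
Local Open Scope ring_scope.

(* C stands for the field of complex numbers throughout. *)
Section Dual.
Variables (C : numClosedFieldType) (V : finZmodType).

(* Homomorphisms V -> U(1), as functions with values in C. *)
Definition is_char (f : {ffun V -> C}) : bool :=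
  [forall u, forall v, f (u + v) == f u * f v] && [forall u, `|f u| == 1].

Record dual : Type := Dual { dual_val :> {ffun V -> C}; _ : is_char dual_val }.

HB.instance Definition _ := [isSub for dual_val].
HB.instance Definition _ := [Choice of dual by <:].

Lemma dualP (x y : dual) : x =1 y -> x = y.
Proof. by move=> exy; apply/val_inj/ffunP. Qed.

Lemma dualD (x : dual) u v : x (u + v) = x u * x v.
Proof. by case: x => f /= /andP[/forallP/(_ u)/forallP/(_ v)/eqP]. Qed.

Lemma dual_norm (x : dual) u : `|x u| = 1.
Proof. by case: x => f /= /andP[_ /forallP/(_ u)/eqP]. Qed.

Lemma dual_neq0 (x : dual) u : x u != 0.
Proof. by rewrite -normr_eq0 dual_norm oner_eq0. Qed.

Lemma dual0 (x : dual) : x 0 = 1.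
Proof. by apply: (mulfI (dual_neq0 x 0)); rewrite -dualD addr0 mulr1. Qed.

Lemma dualN (x : dual) u : x (- u) = (x u)^-1.
Proof.
by apply: (mulfI (dual_neq0 x u)); rewrite -dualD subrr dual0 mulfV ?dual_neq0.
Qed.

Lemma dualMn (x : dual) u n : x (u *+ n) = x u ^+ n.
Proof. by elim: n => [|n IH]; rewrite ?dual0 // mulrS dualD IH exprS. Qed.

Lemma mk_charP (f : V -> C) :
  (forall u v, f (u + v) = f u * f v) -> (forall u, `|f u| = 1) ->
  is_char (finfun f).
Proof.
move=> fD f1; apply/andP; split.
  by apply/forallP => u; apply/forallP => v; rewrite !ffunE fD.
by apply/forallP => u; rewrite ffunE f1.
Qed.

Lemma dual_zero_proof : is_char (finfun (fun _ : V => 1 : C)).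
Proof. by apply: mk_charP => *; rewrite ?mulr1 ?normr1. Qed.

Lemma dual_add_proof (x y : dual) : is_char (finfun (fun u => x u * y u)).
Proof.
apply: mk_charP => [u v|u]; first by rewrite !dualD mulrACA.
by rewrite normrM !dual_norm mulr1.
Qed.

Lemma dual_opp_proof (x : dual) : is_char (finfun (fun u => (x u)^-1)).
Proof.
apply: mk_charP => [u v|u]; first by rewrite !dualD invfM.
by rewrite normfV dual_norm invr1.
Qed.

(* The group law of the character group, pointwise product, is written
   additively. *)
Definition dual_zero : dual := Dual dual_zero_proof.
Definition dual_add (x y : dual) : dual := Dual (dual_add_proof x y).
Definition dual_opp (x : dual) : dual := Dual (dual_opp_proof x).

Lemma dual_addA : associative dual_add.
Proof. by move=> x y z; apply: dualP => u; rewrite !ffunE mulrA. Qed.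
Lemma dual_addC : commutative dual_add.
Proof. by move=> x y; apply: dualP => u; rewrite !ffunE mulrC. Qed.
Lemma dual_add0 : left_id dual_zero dual_add.
Proof. by move=> x; apply: dualP => u; rewrite !ffunE mul1r. Qed.
Lemma dual_addN : left_inverse dual_zero dual_opp dual_add.
Proof.
by move=> x; apply: dualP => u; rewrite !ffunE mulVf ?dual_neq0.
Qed.

HB.instance Definition _ :=
  GRing.isZmodule.Build dual dual_addA dual_addC dual_add0 dual_addN.

Lemma dual_zeroE u : (0 : dual) u = 1. Proof. exact: ffunE. Qed.
Lemma dual_addE (x y : dual) u : (x + y) u = x u * y u.
Proof. exact: ffunE. Qed.
Lemma dual_oppE (x : dual) u : (- x) u = (x u)^-1.
Proof. exact: ffunE. Qed.

(* Finiteness: the values are #|V|-th roots of unity. *)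
Lemma mulrn_card (u : V) : u *+ #|V| = 0.
Proof.
have /(addrI (\sum_(v : V) v)) : \sum_(v : V) v + u *+ #|V| = \sum_(v : V) v + 0.
  rewrite addr0 -sumr_const -big_split /=.
  by rewrite [RHS](reindex_inj (addIr u)).
by [].
Qed.

Lemma dual_expr_card (x : dual) u : x u ^+ #|V| = 1.
Proof. by rewrite -dualMn mulrn_card dual0. Qed.

Definition dual_roots : seq C :=
  sval (closed_field_poly_normal ('X^#|V| - 1 : {poly C})).

Lemma card_zmod_gt0 : (0 < #|V|)%N.
Proof. by apply/card_gt0P; exists 0. Qed.

Lemma dual_rootsP (x : dual) u : x u \in dual_roots.
Proof.
rewrite /dual_roots; case: closed_field_poly_normal => r /= Er.
rewrite -root_prod_XsubC.
have lc : lead_coef ('X^#|V| - 1 : {poly C}) = 1.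
  by apply/eqP; rewrite -monicE monicXnsubC // card_zmod_gt0.
move: Er; rewrite lc scale1r => <-.
by rewrite /root !hornerE dual_expr_card subrr.
Qed.

Definition dual_code (x : dual) : {ffun V -> seq_sub dual_roots} :=
  [ffun u => SeqSub (dual_rootsP x u)].
Definition dual_decode (g : {ffun V -> seq_sub dual_roots}) : option dual :=
  insub [ffun u => ssval (g u)].

Lemma dual_codeK : pcancel dual_code dual_decode.
Proof.
move=> x; rewrite /dual_decode.
have -> : [ffun u => ssval (dual_code x u)] = val x.
  by apply/ffunP => u; rewrite !ffunE.
by rewrite valK.
Qed.

HB.instance Definition _ : isCountable dual := PCanIsCountable dual_codeK.
HB.instance Definition _ : isFinite dual := PCanIsFinite dual_codeK.

End Dual.


Section Orthogonality.
Variables (C : numClosedFieldType) (V : finZmodType).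

Lemma dual_separates (x : V) : x != 0 -> exists f : dual C V, f x != 1.
Proof.
move=> x_neq0; have n_gt0 := card_zmod_gt0 V.
pose n := #|V|.-1; have En : n.+1 = #|V| by rewrite prednK.
pose h (i : 'I_n.+1) : V := enum_val (cast_ord En i).
pose k (v : V) : 'I_n.+1 := cast_ord (esym En) (enum_rank v).
have hk : cancel k h by move=> v; rewrite /h /k cast_ordKV enum_rankK.
have kh : cancel h k by move=> i; rewrite /h /k enum_valK cast_ordK.
have s_inj v : injective (fun i => k (h i + v)).
  by move=> i j /(can_inj hk) /addIr /(can_inj kh).
pose s v : 'S_n.+1 := perm (@s_inj v).
have sD u v : s (u + v) = (s u * s v)%g.
  by apply/permP => i; rewrite permM !permE hk addrA.
pose R v : 'M[C]_n.+1 := perm_mx (s v).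
have RD u v : R (u + v) = R u *m R v by rewrite /R sD perm_mxM.
have s0 : s 0 = 1%g by apply/permP => i; rewrite perm1 permE /= addr0 kh.
have R0 : R 0 = 1%:M by rewrite /R s0 perm_mx1.
have Rn v m : R v ^+ m = R (v *+ m).
  by elim: m => [|m IH]; rewrite ?R0 // exprS IH mulrS RD.
have diagR v : diagonalizable (R v).
  apply/diagonalizableP.
  have [r Er] := closed_field_poly_normal ('X^#|V| - 1 : {poly C}).
  move: Er; rewrite (eqP (_ : lead_coef _ == 1)); last first.
    by rewrite -monicE monicXnsubC.
  rewrite scale1r => Er; exists r.
    rewrite -separable_prod_XsubC -Er; apply: separable_Xn_sub_1.
    by rewrite pnatr_eq0 -lt0n.
  rewrite -Er; apply: mxminpoly_min.
  rewrite rmorphB rmorph1 rmorphXn /= horner_mx_X Rn mulrn_card R0.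
  by rewrite subrr.
have [P Pu /allP dP] : codiagonalizable [seq R v | v : V].
  apply/codiagonalizableP; split=> [f g /mapP[u _ ->] /mapP[v _ ->]|].
    by rewrite /comm_mx -!RD addrC.
  by move=> f /mapP[u _ ->].
pose D v := P *m R v *m invmx P.
have Ddiag v : is_diag_mx (D v).
  have : R v \in [seq R v | v : V] by apply/map_f; rewrite mem_enum.
  by move=> /dP; rewrite /= /similar_to conjumx.
have DD u v : D (u + v) = D u *m D v.
  by rewrite /D RD !mulmxA mulmxKV.
have D0 : D 0 = 1%:M by rewrite /D R0 mulmx1 mulmxV.
pose f i v := D v i i.
have fD i u v : f i (u + v) = f i u * f i v.
  rewrite /f DD mxE (bigD1 i) //= big1 ?addr0 // => j ji.
  have /is_diag_mxP/(_ i j) := Ddiag u.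
  by rewrite (inj_eq val_inj) eq_sym ji => -> //; rewrite mul0r.
have f0 i : f i 0 = 1 by rewrite /f D0 mxE eqxx.
have fn i u m : f i (u *+ m) = f i u ^+ m.
  by elim: m => [|m IH]; rewrite ?f0 // mulrS fD IH exprS.
have f1 i u : `|f i u| = 1.
  apply/eqP; rewrite -(@pexpr_eq1 _ _ #|V|) ?normr_ge0 //.
  by rewrite -normrX -fn mulrn_card f0 normr1.
suff [i fi] : exists i, f i x != 1.
  by exists (Dual (mk_charP (fD i) (f1 i))); rewrite ffunE.
apply/existsP; apply: contraNT x_neq0; rewrite negb_exists => /forallP fx.
have Dx : D x = 1%:M.
  apply/matrixP => i j; rewrite [RHS]mxE; have [<-|ij] := eqVneq i j.
    by have := fx i; rewrite negbK mulr1n => /eqP.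
  by have /is_diag_mxP/(_ i j) := Ddiag x; rewrite (inj_eq val_inj); apply.
have Rx : R x = 1%:M.
  have : invmx P *m D x *m P = 1%:M by rewrite Dx mulmx1 mulVmx.
  by rewrite /D -!mulmxA mulVmx // mulmx1 mulmxA mulVmx // mul1mx.
have : s x (k 0) = k 0.
  have /matrixP/(_ (k 0) (k 0)) := Rx.
  rewrite !mxE eqxx; case: eqP => // _ /eqP.
  by rewrite eq_sym oner_eq0.
by rewrite permE hk add0r => /(can_inj hk) ->.
Qed.

Lemma sum_dual_arg (v : V) :
  \sum_(f : dual C V) f v = if v == 0 then #|{: dual C V}|%:R else 0.
Proof.
case: eqVneq => [->|/dual_separates[g gv]].
  by rewrite -sumr_const; apply: eq_bigr => f _; rewrite dual0.
apply: (mulfI (_ : g v - 1 != 0)); first by rewrite subr_eq0.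
rewrite mulr0 mulrBl mul1r mulr_sumr [X in _ - X](reindex_inj (addrI g)) /=.
by apply/eqP; rewrite subr_eq0; apply/eqP/eq_bigr => f _; rewrite dual_addE.
Qed.

Lemma sum_dual (f : dual C V) :
  \sum_(v : V) f v = if f == 0 then #|V|%:R else 0.
Proof.
case: eqVneq => [->|f_neq0].
  by rewrite -sumr_const; apply: eq_bigr => v _; rewrite dual_zeroE.
have [u fu] : exists u, f u != 1.
  apply/existsP; apply: contraNT f_neq0; rewrite negb_exists => /forallP fx.
  by apply/eqP/dualP => u; rewrite dual_zeroE; apply/eqP/negbNE/fx.
apply: (mulfI (_ : f u - 1 != 0)); first by rewrite subr_eq0.
rewrite mulr0 mulrBl mul1r mulr_sumr [X in _ - X](reindex_inj (addrI u)) /=.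
by apply/eqP; rewrite subr_eq0; apply/eqP/eq_bigr => v _; rewrite dualD.
Qed.

Lemma card_dual : #|{: dual C V}| = #|V|.
Proof.
have : \sum_(v : V) \sum_(f : dual C V) f v =
       \sum_(f : dual C V) \sum_(v : V) f v by rewrite exchange_big.
rewrite (bigD1 0) //= sum_dual_arg eqxx big1 => [|v /negPf v0]; last first.
  by rewrite sum_dual_arg v0.
rewrite (bigD1 (0 : dual C V)) // sum_dual eqxx big1 => [|f /negPf f0]; last first.
  by rewrite sum_dual f0.
by rewrite /= !addr0 => E; apply/eqP; rewrite -(eqr_nat C) E.
Qed.

End Orthogonality.

Arguments dual_val {C V} _ : simpl never.

Declare Scope mor_scope.
Delimit Scope mor_scope with mor.
Reserved Notation "f ∘ g" (at level 50, left associativity).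
Reserved Notation "X ⊗₀ Y" (at level 40, left associativity).
Reserved Notation "f ⊗₁ g" (at level 40, left associativity).

(* The data of a k-linear monoidal category; [is_tensor_category] has the
   axioms. *)
Record tensor_cat (k : fieldType) : Type := TensorCat {
  obj :> Type;
  mor : obj -> obj -> lmodType k;
  idm : forall X, mor X X;
  mcomp : forall X Y Z, mor Y Z -> mor X Y -> mor X Z;
  unit_ob : obj;
  tens_ob : obj -> obj -> obj;
  tens_mor : forall X X' Y Y', mor X X' -> mor Y Y' ->
    mor (tens_ob X Y) (tens_ob X' Y');
  assoc : forall X Y Z,
    mor (tens_ob (tens_ob X Y) Z) (tens_ob X (tens_ob Y Z));
  lunit : forall X, mor (tens_ob unit_ob X) X;
  runit : forall X, mor (tens_ob X unit_ob) X }.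

Arguments mor {k t} X Y.
Arguments idm {k t} X.
Arguments mcomp {k t X Y Z} f g.
Arguments unit_ob {k} t.
Arguments tens_ob {k t} X Y.
Arguments tens_mor {k t X X' Y Y'} f g.
Arguments assoc {k t} X Y Z.
Arguments lunit {k t} X.
Arguments runit {k t} X.

Notation "f ∘ g" := (mcomp f g) : mor_scope.
Notation "f ⊗₁ g" := (tens_mor f g) : mor_scope.
Notation "X ⊗₀ Y" := (tens_ob X Y) : mor_scope.
Local Open Scope mor_scope.

Definition is_iso (k : fieldType) (T : tensor_cat k) (X Y : T)
    (f : mor X Y) : Prop :=
  exists g : mor Y X, g ∘ f = idm X /\ f ∘ g = idm Y.

Record is_tensor_category (k : fieldType) (T : tensor_cat k) : Prop := {
  tc_compA : forall (X Y Z W : T) (f : mor Z W) (g : mor Y Z) (h : mor X Y),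
    f ∘ (g ∘ h) = f ∘ g ∘ h;
  tc_id_l : forall (X Y : T) (f : mor X Y), idm Y ∘ f = f;
  tc_id_r : forall (X Y : T) (f : mor X Y), f ∘ idm X = f;
  tc_comp_linear_l : forall (X Y Z : T) (g : mor X Y),
    linear (fun f : mor Y Z => f ∘ g);
  tc_comp_linear_r : forall (X Y Z : T) (f : mor Y Z),
    linear (fun g : mor X Y => f ∘ g);
  tc_tens_id : forall X Y : T, idm X ⊗₁ idm Y = idm (X ⊗₀ Y);
  tc_tens_comp : forall (X X' X'' Y Y' Y'' : T)
    (f' : mor X' X'') (f : mor X X') (g' : mor Y' Y'') (g : mor Y Y'),
    (f' ∘ f) ⊗₁ (g' ∘ g) = (f' ⊗₁ g') ∘ (f ⊗₁ g);
  tc_tens_linear_l : forall (X X' Y Y' : T) (g : mor Y Y'),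
    linear (fun f : mor X X' => f ⊗₁ g);
  tc_tens_linear_r : forall (X X' Y Y' : T) (f : mor X X'),
    linear (fun g : mor Y Y' => f ⊗₁ g);
  tc_assoc_iso : forall X Y Z : T, is_iso (assoc X Y Z);
  tc_lunit_iso : forall X : T, is_iso (lunit X);
  tc_runit_iso : forall X : T, is_iso (runit X);
  tc_assoc_nat : forall (X X' Y Y' Z Z' : T)
    (f : mor X X') (g : mor Y Y') (h : mor Z Z'),
    assoc X' Y' Z' ∘ ((f ⊗₁ g) ⊗₁ h) = (f ⊗₁ (g ⊗₁ h)) ∘ assoc X Y Z;
  tc_lunit_nat : forall (X X' : T) (f : mor X X'),
    lunit X' ∘ (idm (unit_ob T) ⊗₁ f) = f ∘ lunit X;
  tc_runit_nat : forall (X X' : T) (f : mor X X'),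
    runit X' ∘ (f ⊗₁ idm (unit_ob T)) = f ∘ runit X;
  tc_pentagon : forall X Y Z W : T,
    assoc X Y (Z ⊗₀ W) ∘ assoc (X ⊗₀ Y) Z W =
    (idm X ⊗₁ assoc Y Z W) ∘ assoc X (Y ⊗₀ Z) W ∘ (assoc X Y Z ⊗₁ idm W);
  tc_triangle : forall X Y : T,
    (idm X ⊗₁ lunit Y) ∘ assoc X (unit_ob T) Y = runit X ⊗₁ idm Y }.

Record symmetric_tensor_cat (k : fieldType) : Type := SymmetricTensorCat {
  tensor_part :> tensor_cat k;
  braid : forall X Y : tensor_part, mor (X ⊗₀ Y) (Y ⊗₀ X) }.

Arguments braid {k s} X Y.

(* The second hexagon follows from the first one and symmetry. *)
Record is_symmetric_tensor_category (k : fieldType)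
    (T : symmetric_tensor_cat k) : Prop := {
  sc_tensor : is_tensor_category T;
  sc_braid_nat : forall (X X' Y Y' : T) (f : mor X X') (g : mor Y Y'),
    braid X' Y' ∘ (f ⊗₁ g) = (g ⊗₁ f) ∘ braid X Y;
  sc_symmetry : forall X Y : T, braid Y X ∘ braid X Y = idm (X ⊗₀ Y);
  sc_hexagon : forall X Y Z : T,
    assoc Y Z X ∘ braid X (Y ⊗₀ Z) ∘ assoc X Y Z =
    (idm Y ⊗₁ braid X Z) ∘ assoc Y X Z ∘ (braid X Y ⊗₁ idm Z) }.

Record tensor_functor (k : fieldType) (S T : tensor_cat k) : Type :=
  TensorFunctor {
    fob :> S -> T;
    fmor : forall X Y : S, mor X Y -> mor (fob X) (fob Y);
    ftens : forall X Y : S, mor (fob X ⊗₀ fob Y) (fob (X ⊗₀ Y));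
    funit : mor (unit_ob T) (fob (unit_ob S)) }.

Arguments fmor {k S T} F {X Y} f : rename.
Arguments ftens {k S T} F X Y : rename.
Arguments funit {k S T} F : rename.

Record is_tensor_functor (k : fieldType) (S T : tensor_cat k)
    (F : tensor_functor S T) : Prop := {
  tf_id : forall X : S, fmor F (idm X) = idm (F X);
  tf_comp : forall (X Y Z : S) (f : mor Y Z) (g : mor X Y),
    fmor F (f ∘ g) = fmor F f ∘ fmor F g;
  tf_linear : forall X Y : S, linear (@fmor _ _ _ F X Y);
  tf_tens_iso : forall X Y : S, is_iso (ftens F X Y);
  tf_unit_iso : is_iso (funit F);
  tf_tens_nat : forall (X X' Y Y' : S) (f : mor X X') (g : mor Y Y'),
    ftens F X' Y' ∘ (fmor F f ⊗₁ fmor F g) = fmor F (f ⊗₁ g) ∘ ftens F X Y;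
  tf_assoc : forall X Y Z : S,
    fmor F (assoc X Y Z) ∘ ftens F (X ⊗₀ Y) Z ∘ (ftens F X Y ⊗₁ idm (F Z)) =
    ftens F X (Y ⊗₀ Z) ∘ (idm (F X) ⊗₁ ftens F Y Z) ∘ assoc (F X) (F Y) (F Z);
  tf_lunit : forall X : S,
    fmor F (lunit X) ∘ ftens F (unit_ob S) X ∘ (funit F ⊗₁ idm (F X)) =
    lunit (F X);
  tf_runit : forall X : S,
    fmor F (runit X) ∘ ftens F X (unit_ob S) ∘ (idm (F X) ⊗₁ funit F) =
    runit (F X) }.

Record is_symmetric_tensor_functor (k : fieldType)
    (S T : symmetric_tensor_cat k) (F : tensor_functor S T) : Prop := {
  sf_tensor : is_tensor_functor F;
  sf_braid : forall X Y : S,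
    fmor F (braid X Y) ∘ ftens F X Y = ftens F Y X ∘ braid (F X) (F Y) }.

Definition id_functor (k : fieldType) (T : tensor_cat k) :
    tensor_functor T T :=
  @TensorFunctor k T T id (fun X Y => id) (fun X Y => idm (X ⊗₀ Y))
    (idm (unit_ob T)).

Definition comp_functor (k : fieldType) (R S T : tensor_cat k)
    (G : tensor_functor S T) (F : tensor_functor R S) : tensor_functor R T :=
  @TensorFunctor k R T (fun X => G (F X)) (fun X Y f => fmor G (fmor F f))
    (fun X Y => fmor G (ftens F X Y) ∘ ftens G (F X) (F Y))
    (fmor G (funit F) ∘ funit G).

(* The composites are required to be the identity tensor functors strictly,
   as equalities between the whole data. *)
Definition is_symmetric_tensor_isomorphism (k : fieldType)
    (S T : symmetric_tensor_cat k) (F : tensor_functor S T) : Prop :=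
  is_symmetric_tensor_functor F /\
  exists G : tensor_functor T S,
    [/\ is_symmetric_tensor_functor G,
        comp_functor G F = id_functor S &
        comp_functor F G = id_functor T].

Arguments is_symmetric_tensor_isomorphism {k} S T F.

(* The tensor product of vector spaces, in coordinates on the library's bases;
   [tlift_tensv] and [tens_ext] are its universal property. *)
Section TensorProduct.
Variable C : fieldType.
Implicit Types U V W X : vectType C.

Definition tens U V : vectType C := 'M[C]_(\dim {:U}, \dim {:V}).

Definition tensv U V (u : U) (v : V) : tens U V :=
  \matrix_(i, j) (coord (vbasis {:U}) i u * coord (vbasis {:V}) j v).

Definition bilin U V W (b : U -> V -> W) : Prop :=
  (forall v, linear (b^~ v)) /\ (forall u, linear (b u)).

Definition tlift_fun U V W (b : U -> V -> W) (t : tens U V) : W :=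
  \sum_i \sum_j (t : 'M_(_, _)) i j *: b (vbasis {:U})`_i (vbasis {:V})`_j.

Lemma tlift_is_linear U V W (b : U -> V -> W) : linear (tlift_fun b).
Proof.
move=> a s t; rewrite /tlift_fun scaler_sumr -big_split; apply: eq_bigr => i _.
rewrite scaler_sumr -big_split; apply: eq_bigr => j _ /=.
by rewrite !mxE scalerDl scalerA.
Qed.

HB.instance Definition _ U V W b := GRing.isLinear.Build C (tens U V) W *:%R
  (@tlift_fun U V W b) (@tlift_is_linear U V W b).

(* The linear map induced by a bilinear one. *)
Definition tlift U V W (b : U -> V -> W) : 'Hom(tens U V, W) :=
  linfun (tlift_fun b).

Lemma bilin_sum U V W (b : U -> V -> W) : bilin b ->
  forall (I J : finType) (x : I -> U) (y : J -> V) (a : I -> C) (c : J -> C),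
  b (\sum_i a i *: x i) (\sum_j c j *: y j) =
  \sum_i \sum_j (a i * c j) *: b (x i) (y j).
Proof.
move=> [bl br] I J x y a c.
pose bL v : {linear U -> W} := HB.pack (b^~ v) (GRing.isLinear.Build _ _ _ _ _ (bl v)).
pose bR u : {linear V -> W} := HB.pack (b u) (GRing.isLinear.Build _ _ _ _ _ (br u)).
rewrite -[LHS]/(bL _ _) linear_sum; apply: eq_bigr => i _.
rewrite linearZ /= -[b _ _]/(bR _ _) linear_sum scaler_sumr.
by apply: eq_bigr => j _; rewrite linearZ /= scalerA.
Qed.

Lemma coord_vbasisT U (u : U) :
  u = \sum_i coord (vbasis {:U}) i u *: (vbasis {:U})`_i.
Proof. exact: coord_vbasis (memvf u). Qed.

Lemma tlift_tensv U V W (b : U -> V -> W) u v : bilin b ->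
  tlift b (tensv u v) = b u v.
Proof.
move=> bb; rewrite [in RHS](coord_vbasisT u) [in RHS](coord_vbasisT v).
rewrite bilin_sum // lfunE /= /tlift_fun; apply: eq_bigr => i _.
by apply: eq_bigr => j _; rewrite mxE.
Qed.

Lemma tensv_bilin U V : bilin (@tensv U V).
Proof.
by split=> w a s t; apply/matrixP => i j;
  rewrite !mxE linearP /= ?mulrDl ?mulrDr -?mulrA // mulrCA.
Qed.

Lemma tens_ext U V W (f g : 'Hom(tens U V, W)) :
  (forall u v, f (tensv u v) = g (tensv u v)) -> f = g.
Proof.
move=> fg; apply/lfunP => t.
have -> : t = \sum_i \sum_j (t : 'M_(_, _)) i j *:
    tensv (vbasis {:U})`_i (vbasis {:V})`_j.
  apply: etrans (matrix_sum_delta t) _.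
  apply: eq_bigr => i _; apply: eq_bigr => j _; congr (_ *: _).
  apply/matrixP => k l; rewrite !mxE !coord_free ?(basis_free (vbasisP _)) //.
  by rewrite -natrM mulnb (eq_sym k) (eq_sym l).
rewrite !linear_sum; apply: eq_bigr => i _.
by rewrite !linear_sum; apply: eq_bigr => j _; rewrite !linearZ /= fg.
Qed.

Lemma bilin_comp U V W X (b : U -> V -> W) (f : 'Hom(W, X)) :
  bilin b -> bilin (fun u v => f (b u v)).
Proof. by move=> [bl br]; split=> w a s t /=; rewrite ?bl ?br linearP. Qed.

Lemma bilin_map U V U' V' W (b : U' -> V' -> W) (f : 'Hom(U, U'))
    (g : 'Hom(V, V')) : bilin b -> bilin (fun u v => b (f u) (g v)).
Proof. by move=> [bl br]; split=> w a s t; rewrite linearP ?bl ?br. Qed.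

Lemma bilin_flip U V W (b : U -> V -> W) :
  bilin b -> bilin (fun v u => b u v).
Proof. by move=> [bl br]; split. Qed.

Lemma bilin_scale U V W (b : U -> V -> W) (c : C) :
  bilin b -> bilin (fun u v => c *: b u v).
Proof.
by move=> [bl br]; split=> w a s t; rewrite ?bl ?br scalerDr !scalerA mulrC.
Qed.

Lemma bilin_bigsum U V W (I : finType) (b : I -> U -> V -> W) :
  (forall i, bilin (b i)) -> bilin (fun u v => \sum_i b i u v).
Proof.
move=> bb; split=> w a s t; rewrite scaler_sumr -big_split /=;
by apply: eq_bigr => i _; have [bl br] := bb i; rewrite ?bl ?br.
Qed.

Lemma tensvDl U V (u u' : U) (v : V) :
  tensv (u + u') v = tensv u v + tensv u' v.
Proof. by have [/(_ v 1 u u')] := tensv_bilin U V; rewrite !scale1r. Qed.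
Lemma tensvDr U V (u : U) (v v' : V) :
  tensv u (v + v') = tensv u v + tensv u v'.
Proof. by have [_ /(_ u 1 v v')] := tensv_bilin U V; rewrite !scale1r. Qed.
Lemma tensvZl U V a (u : U) (v : V) : tensv (a *: u) v = a *: tensv u v.
Proof.
have [/(_ v a u 0)] := tensv_bilin U V; rewrite addr0 => -> _.
by rewrite (_ : tensv 0 v = 0) ?addr0 //; apply/matrixP => i j;
  rewrite !mxE linear0 mul0r.
Qed.
Lemma tensvZr U V a (u : U) (v : V) : tensv u (a *: v) = a *: tensv u v.
Proof.
have [_ /(_ u a v 0)] := tensv_bilin U V; rewrite addr0 => ->.
by rewrite (_ : tensv u 0 = 0) ?addr0 //; apply/matrixP => i j;
  rewrite !mxE linear0 mulr0.
Qed.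

Lemma tens_ext3 U V W X (f g : 'Hom(tens (tens U V) W, X)) :
  (forall u v w, f (tensv (tensv u v) w) = g (tensv (tensv u v) w)) -> f = g.
Proof.
move=> fg; apply: tens_ext => t w.
pose L : {linear tens U V -> tens (tens U V) W} := HB.pack
  (fun t => tensv t w)
  (GRing.isLinear.Build _ _ _ _ _ ((tensv_bilin (tens U V) W).1 w)).
have LE s : tensv s w = linfun L s by rewrite lfunE.
rewrite LE -!comp_lfunE.
congr (fun_of_lfun _ t); apply: tens_ext => u v.
by rewrite !comp_lfunE -!LE fg.
Qed.

Definition tmap U V U' V' (f : 'Hom(U, U')) (g : 'Hom(V, V')) :
    'Hom(tens U V, tens U' V') :=
  tlift (fun u v => tensv (f u) (g v)).

Lemma tmapE U V U' V' (f : 'Hom(U, U')) (g : 'Hom(V, V')) u v :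
  tmap f g (tensv u v) = tensv (f u) (g v).
Proof. by apply: tlift_tensv; apply/bilin_map/tensv_bilin. Qed.

Definition tassoc U V W : 'Hom(tens (tens U V) W, tens U (tens V W)) :=
  tlift (fun t w => tlift (fun u v => tensv u (tensv v w)) t).

Lemma tassocE U V W (u : U) (v : V) (w : W) :
  tassoc U V W (tensv (tensv u v) w) = tensv u (tensv v w).
Proof.
have b1 w' : bilin (fun (u : U) (v : V) => tensv u (tensv v w')).
  by split=> [v' | u'] a s t; rewrite !(tensvDl, tensvDr, tensvZl, tensvZr).
rewrite tlift_tensv ?tlift_tensv //; split=> [w'|t] a s s'; rewrite ?linearP //.
have -> : tlift (fun (u : U) (v : V) => tensv u (tensv v (a *: s + s'))) =
    a *: tlift (fun (u : U) (v : V) => tensv u (tensv v s)) +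
    tlift (fun (u : U) (v : V) => tensv u (tensv v s')).
  apply: tens_ext => u' v'.
  by rewrite add_lfunE scale_lfunE !tlift_tensv // !(tensvDr, tensvZr).
by rewrite add_lfunE scale_lfunE.
Qed.

Definition tlunit U : 'Hom(tens C^o U, U) := tlift (fun (a : C^o) u => a *: u).

Lemma tlunitE U (a : C^o) (u : U) : tlunit U (tensv a u) = a *: u.
Proof.
apply: tlift_tensv; split=> w b s t; rewrite ?scalerDl ?scalerDr ?scalerA //.
by rewrite mulrC.
Qed.

Definition trunit U : 'Hom(tens U C^o, U) := tlift (fun u (a : C^o) => a *: u).

Lemma trunitE U (a : C^o) (u : U) : trunit U (tensv u a) = a *: u.
Proof.
apply: tlift_tensv; split=> w b s t; rewrite ?scalerDl ?scalerDr ?scalerA //.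
by rewrite mulrC.
Qed.

Definition tflip U V : 'Hom(tens U V, tens V U) :=
  tlift (fun u v => tensv v u).

Lemma tflipE U V (u : U) (v : V) : tflip U V (tensv u v) = tensv v u.
Proof. by apply: tlift_tensv; apply/bilin_flip/tensv_bilin. Qed.

End TensorProduct.

Section Representations.
Variables (C : fieldType) (G : groupType).

Record rep : Type := Rep {
  rep_space :> vectType C;
  rep_act : G -> 'End(rep_space);
  rep_act1 : rep_act 1%g = \1%VF;
  rep_actM : forall g h, rep_act (g * h)%g = (rep_act g \o rep_act h)%VF }.

Definition equivariant (U W : rep) : {pred 'Hom(U, W)} :=
  fun f => `[< forall g, (f \o rep_act U g = rep_act W g \o f)%VF >].

Record rep_hom (U W : rep) : Type := RepHom {
  rep_hom_val :> 'Hom(U, W);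
  _ : rep_hom_val \in @equivariant U W }.

Lemma equivariantP (U W : rep) (f : 'Hom(U, W)) :
  reflect (forall g x, f (rep_act U g x) = rep_act W g (f x))
    (f \in @equivariant U W).
Proof.
apply: (iffP (asboolP _)) => H g; last first.
  by apply/lfunP => x; rewrite !comp_lfunE H.
by move=> x; rewrite -!comp_lfunE H.
Qed.

Lemma equivariant_submod_closed (U W : rep) :
  submod_closed (@equivariant U W).
Proof.
split; first by apply/equivariantP => g x; rewrite !zero_lfunE linear0.
move=> a f h /equivariantP fP /equivariantP hP; apply/equivariantP => g x.
by rewrite !add_lfunE !scale_lfunE fP hP linearP.
Qed.

HB.instance Definition _ (U W : rep) := GRing.isSubmodClosed.Build C
  'Hom(U, W) (@equivariant U W) (@equivariant_submod_closed U W).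
HB.instance Definition _ (U W : rep) :=
  [isSub of rep_hom U W for @rep_hom_val U W].
HB.instance Definition _ (U W : rep) := [Choice of rep_hom U W by <:].
HB.instance Definition _ (U W : rep) :=
  [SubChoice_isSubLmodule of rep_hom U W by <:].

Definition mk_rep_hom (U W : rep) (f : 'Hom(U, W))
    (fP : forall g x, f (rep_act U g x) = rep_act W g (f x)) : rep_hom U W :=
  RepHom (introT (equivariantP f) fP).

Lemma rep_homE (U W : rep) (f : rep_hom U W) g x :
  f (rep_act U g x) = rep_act W g (f x).
Proof. by case: f => f /= /equivariantP. Qed.

Lemma rep_id_proof (U : rep) g x :
  \1%VF (rep_act U g x) = rep_act U g (\1%VF x).
Proof. by rewrite !id_lfunE. Qed.

Definition rep_id (U : rep) : rep_hom U U := @mk_rep_hom U U \1%VF (@rep_id_proof U).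

Lemma rep_comp_proof (U V W : rep) (f : rep_hom V W) (h : rep_hom U V) g x :
  (f \o h)%VF (rep_act U g x) = rep_act W g ((f \o h)%VF x).
Proof. by rewrite !comp_lfunE !rep_homE. Qed.

Definition rep_comp (U V W : rep) (f : rep_hom V W) (h : rep_hom U V) :
  rep_hom U W := @mk_rep_hom U W (f \o h)%VF (rep_comp_proof f h).

Lemma rep_unit_actM (g h : G) : \1%VF = (\1 \o \1)%VF :> 'End(C^o).
Proof. by rewrite comp_lfun1l. Qed.

Definition rep_unit : rep :=
  @Rep C^o (fun=> \1%VF) erefl rep_unit_actM.

Lemma rep_tens_act1 (U W : rep) :
  tmap (rep_act U 1%g) (rep_act W 1%g) = \1%VF.
Proof. by apply: tens_ext => u w; rewrite tmapE !rep_act1 !id_lfunE. Qed.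

Lemma rep_tens_actM (U W : rep) g h :
  tmap (rep_act U (g * h)%g) (rep_act W (g * h)%g) =
  (tmap (rep_act U g) (rep_act W g) \o tmap (rep_act U h) (rep_act W h))%VF.
Proof.
by apply: tens_ext => u w; rewrite comp_lfunE !tmapE !rep_actM !comp_lfunE.
Qed.

Definition rep_tens (U W : rep) : rep :=
  @Rep (tens U W) (fun g => tmap (rep_act U g) (rep_act W g))
    (rep_tens_act1 U W) (rep_tens_actM U W).

Lemma rep_tensE (U W : rep) g (u : U) (w : W) :
  rep_act (rep_tens U W) g (tensv u w) =
  tensv (rep_act U g u) (rep_act W g w).
Proof. exact: tmapE. Qed.

Lemma tens_equivariant (U W X : rep) (f : 'Hom(rep_tens U W, X)) :
  (forall g (u : U) (w : W), f (tensv (rep_act U g u) (rep_act W g w)) =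
     rep_act X g (f (tensv u w))) ->
  forall g x, f (rep_act (rep_tens U W) g x) = rep_act X g (f x).
Proof.
move=> fP g x; rewrite -!comp_lfunE; congr (fun_of_lfun _ x).
by apply: tens_ext => u w; rewrite !comp_lfunE rep_tensE fP.
Qed.

Lemma rep_tens_mor_proof (U U' W W' : rep) (f : rep_hom U U')
    (h : rep_hom W W') g (x : rep_tens U W) :
  tmap f h (rep_act (rep_tens U W) g x) =
  rep_act (rep_tens U' W') g (tmap f h x).
Proof.
move: g x; apply: (@tens_equivariant U W (rep_tens U' W')) => g u w.
by rewrite !tmapE !rep_homE.
Qed.

Definition rep_tens_mor (U U' W W' : rep) (f : rep_hom U U')
    (h : rep_hom W W') : rep_hom (rep_tens U W) (rep_tens U' W') :=
  @mk_rep_hom (rep_tens U W) (rep_tens U' W') (tmap f h)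
    (rep_tens_mor_proof f h).

Lemma rep_assoc_proof (U V W : rep) g x :
  tassoc U V W (rep_act (rep_tens (rep_tens U V) W) g x) =
  rep_act (rep_tens U (rep_tens V W)) g (tassoc U V W x).
Proof.
rewrite -!comp_lfunE; congr (fun_of_lfun _ x).
apply: tens_ext3 => u v w; rewrite !comp_lfunE.
by rewrite (@rep_tensE (rep_tens U V) W) rep_tensE !tassocE
  (@rep_tensE U (rep_tens V W)) rep_tensE.
Qed.

Definition rep_assoc (U V W : rep) :
    rep_hom (rep_tens (rep_tens U V) W) (rep_tens U (rep_tens V W)) :=
  @mk_rep_hom (rep_tens (rep_tens U V) W) (rep_tens U (rep_tens V W))
    (tassoc U V W) (@rep_assoc_proof U V W).

Lemma rep_lunit_proof (U : rep) g x :
  tlunit U (rep_act (rep_tens rep_unit U) g x) = rep_act U g (tlunit U x).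
Proof.
move: g x; apply: (@tens_equivariant rep_unit U U) => g a u.
by rewrite id_lfunE !tlunitE linearZ.
Qed.

Definition rep_lunit (U : rep) : rep_hom (rep_tens rep_unit U) U :=
  @mk_rep_hom (rep_tens rep_unit U) U (tlunit U) (@rep_lunit_proof U).

Lemma rep_runit_proof (U : rep) g x :
  trunit U (rep_act (rep_tens U rep_unit) g x) = rep_act U g (trunit U x).
Proof.
move: g x; apply: (@tens_equivariant U rep_unit U) => g u a.
by rewrite id_lfunE !trunitE linearZ.
Qed.

Definition rep_runit (U : rep) : rep_hom (rep_tens U rep_unit) U :=
  @mk_rep_hom (rep_tens U rep_unit) U (trunit U) (@rep_runit_proof U).

Lemma rep_flip_proof (U W : rep) g x :
  tflip U W (rep_act (rep_tens U W) g x) =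
  rep_act (rep_tens W U) g (tflip U W x).
Proof.
move: g x; apply: (@tens_equivariant U W (rep_tens W U)) => g u w.
by rewrite !tflipE rep_tensE.
Qed.

Definition rep_flip (U W : rep) : rep_hom (rep_tens U W) (rep_tens W U) :=
  @mk_rep_hom (rep_tens U W) (rep_tens W U) (tflip U W)
    (@rep_flip_proof U W).

Definition Rep_tensor_cat : tensor_cat C :=
  @TensorCat C rep rep_hom rep_id rep_comp rep_unit rep_tens rep_tens_mor
    rep_assoc rep_lunit rep_runit.

Definition Rep_symmetric : symmetric_tensor_cat C :=
  @SymmetricTensorCat C Rep_tensor_cat rep_flip.

End Representations.

Section CliffordGroup.
Variables (C : numClosedFieldType) (A : finZmodType).

(* V_A, an element being a pair (a, chi). *)
Definition phase : Type := (A * dual C A)%type.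
HB.instance Definition _ := GRing.Zmodule.on phase.
HB.instance Definition _ := Finite.on phase.

Definition beta (u v : phase) : C := u.2 v.1.
Definition omega (u v : phase) : C := beta u v * (beta v u)^-1.

Lemma betaDl u u' v : beta (u + u') v = beta u v * beta u' v.
Proof. by rewrite /beta dual_addE. Qed.
Lemma betaDr u v v' : beta u (v + v') = beta u v * beta u v'.
Proof. by rewrite /beta dualD. Qed.
Lemma beta_neq0 u v : beta u v != 0.
Proof. exact: dual_neq0. Qed.
Lemma beta_norm u v : `|beta u v| = 1.
Proof. exact: dual_norm. Qed.

(* {perm phase} is used for automorphisms; the product of {perm _} composes
   from left to right, whence the reversed products below. *)
Definition additive_perm (T : {perm phase}) : bool :=
  [forall u, forall v, T (u + v) == T u + T v].

Definition is_sp (T : {perm phase}) : bool :=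
  additive_perm T && [forall u, forall v, omega (T u) (T v) == omega u v].

Record Sp : Type := MkSp { sp_perm :> {perm phase}; _ : is_sp sp_perm }.

HB.instance Definition _ := [isSub for sp_perm].
HB.instance Definition _ := [Choice of Sp by <:].

Lemma additive_permP (T : {perm phase}) :
  reflect (forall u v, T (u + v) = T u + T v) (additive_perm T).
Proof. by apply: (iffP forallP) => H u; [move=> v|apply/forallP=> v]; 
  apply/eqP => //; move/forallP: (H u). Qed.

Lemma is_spP (T : {perm phase}) :
  reflect ((forall u v, T (u + v) = T u + T v) /\
           (forall u v, omega (T u) (T v) = omega u v)) (is_sp T).
Proof.
apply: (iffP andP) => -[].
  move=> /additive_permP aT /forallP oT; split=> // u v.
  by apply/eqP; move/forallP: (oT u).
move=> aT oT; split; first exact/additive_permP.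
by apply/forallP => u; apply/forallP => v; apply/eqP.
Qed.

Lemma spD (T : Sp) u v : T (u + v) = T u + T v.
Proof. by case: T => T /= /is_spP[]. Qed.
Lemma sp_omega (T : Sp) u v : omega (T u) (T v) = omega u v.
Proof. by case: T => T /= /is_spP[]. Qed.

Lemma additive_perm1 : additive_perm 1%g.
Proof. by apply/additive_permP => u v; rewrite !perm1. Qed.
Lemma additive_permM S T :
  additive_perm S -> additive_perm T -> additive_perm (S * T)%g.
Proof.
move=> /additive_permP aS /additive_permP aT; apply/additive_permP => u v.
by rewrite !permM aS aT.
Qed.
Lemma additive_permV T : additive_perm T -> additive_perm T^-1%g.
Proof.
move=> /additive_permP aT; apply/additive_permP => u v.
by apply: (@perm_inj _ T); rewrite aT !permKV.
Qed.

Lemma is_sp1 : is_sp 1%g.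
Proof.
by apply/is_spP; split=> u v; rewrite !perm1.
Qed.
Lemma is_spM (T S : Sp) : is_sp ((S : {perm phase}) * T)%g.
Proof. by apply/is_spP; split=> u v; rewrite !permM ?spD ?sp_omega. Qed.
Lemma is_spV (T : Sp) : is_sp (T : {perm phase})^-1%g.
Proof.
apply/is_spP; split=> u v; last by rewrite -(sp_omega T) !permKV.
by apply: (@perm_inj _ T); rewrite spD !permKV.
Qed.

Definition sp_one : Sp := MkSp is_sp1.
Definition sp_mul (T S : Sp) : Sp := MkSp (is_spM T S).
Definition sp_inv (T : Sp) : Sp := MkSp (is_spV T).

Lemma sp_mulA : associative sp_mul.
Proof. by move=> T S R; apply/val_inj; rewrite /= mulgA. Qed.
Lemma sp_mul1 : left_id sp_one sp_mul.
Proof. by move=> T; apply/val_inj; rewrite /= mulg1. Qed.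
Lemma sp_mul1r : right_id sp_one sp_mul.
Proof. by move=> T; apply/val_inj; rewrite /= mul1g. Qed.
Lemma sp_mulV : left_inverse sp_one sp_inv sp_mul.
Proof. by move=> T; apply/val_inj; rewrite /= mulgV. Qed.
Lemma sp_mulVr : right_inverse sp_one sp_inv sp_mul.
Proof. by move=> T; apply/val_inj; rewrite /= mulVg. Qed.

HB.instance Definition _ :=
  isGroup.Build Sp sp_mulA sp_mul1 sp_mul1r sp_mulV sp_mulVr.

Lemma sp1E u : (1%g : Sp) u = u. Proof. exact: perm1. Qed.
Lemma spME (T S : Sp) u : (T * S)%g u = T (S u). Proof. exact: permM. Qed.
Lemma spVK (T : Sp) u : T (T^-1%g u) = u.
Proof. exact: (@permKV _ (sp_perm T)). Qed.

Lemma sp_pull_proof (f : dual C phase) (T : Sp) :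
  is_char (finfun (fun v => f (T v))).
Proof.
by apply: mk_charP => [u v|u]; rewrite ?dual_norm // spD dualD.
Qed.

Definition sp_pull (f : dual C phase) (T : Sp) : dual C phase :=
  Dual (sp_pull_proof f T).

Lemma sp_pullE f T v : sp_pull f T v = f (T v). Proof. exact: ffunE. Qed.

(* The affine symplectic group. *)
Record ASp : Type := MkASp { asp_lin : Sp; asp_char : dual C phase }.

Definition asp_pair (g : ASp) := (asp_lin g, asp_char g).
Definition pair_asp (p : Sp * dual C phase) := MkASp p.1 p.2.
Lemma asp_pairK : cancel asp_pair pair_asp. Proof. by case. Qed.
HB.instance Definition _ := Choice.copy ASp (can_type asp_pairK).

Definition asp_one : ASp := MkASp 1%g 0.
Definition asp_mul (g h : ASp) : ASp :=
  MkASp (asp_lin g * asp_lin h)%g (sp_pull (asp_char g) (asp_lin h) + asp_char h).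
Definition asp_inv (g : ASp) : ASp :=
  MkASp (asp_lin g)^-1%g (- sp_pull (asp_char g) (asp_lin g)^-1%g).

Lemma asp_eq (g h : ASp) :
  asp_lin g = asp_lin h -> asp_char g =1 asp_char h -> g = h.
Proof. by case: g h => [T f] [S f'] /= -> /dualP ->. Qed.

Lemma asp_mulA : associative asp_mul.
Proof.
move=> g h k; apply: asp_eq => [|v]; rewrite /= ?mulgA //.
by rewrite !(dual_addE, sp_pullE) spME mulrA.
Qed.
Lemma asp_mul1 : left_id asp_one asp_mul.
Proof.
move=> g; apply: asp_eq => [|v]; rewrite /= ?mul1g //.
by rewrite !(dual_addE, sp_pullE, dual_zeroE) mul1r.
Qed.
Lemma asp_mul1r : right_id asp_one asp_mul.
Proof.
move=> g; apply: asp_eq => [|v]; rewrite /= ?mulg1 //.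
by rewrite !(dual_addE, sp_pullE, dual_zeroE) sp1E mulr1.
Qed.
Lemma asp_mulV : left_inverse asp_one asp_inv asp_mul.
Proof.
move=> g; apply: asp_eq => [|v]; rewrite /= ?mulVg //.
rewrite !(dual_addE, sp_pullE, dual_zeroE, dual_oppE) -spME mulVg sp1E.
by rewrite mulVf ?dual_neq0.
Qed.
Lemma asp_mulVr : right_inverse asp_one asp_inv asp_mul.
Proof.
move=> g; apply: asp_eq => [|v]; rewrite /= ?mulgV //.
rewrite !(dual_addE, sp_pullE, dual_zeroE, dual_oppE).
by rewrite mulfV ?dual_neq0.
Qed.

HB.instance Definition _ :=
  isGroup.Build ASp asp_mulA asp_mul1 asp_mul1r asp_mulV asp_mulVr.

(* The projective Clifford group, as the group of pairs (T, l): the pair (T, l)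
   is the class of the unitaries X with X W_u X^* = l u W_{T u} for all u. *)
Definition is_clifford (T : {perm phase}) (l : {ffun phase -> C}) : bool :=
  [&& additive_perm T, [forall u, `|l u| == 1] &
   [forall u, forall v, l (u + v) * (l u)^-1 * (l v)^-1 ==
      beta (T u) (T v) * (beta u v)^-1]].

Record Clifford : Type := MkClifford {
  cl_pair : {perm phase} * {ffun phase -> C};
  _ : is_clifford cl_pair.1 cl_pair.2 }.

HB.instance Definition _ := [isSub for cl_pair].
HB.instance Definition _ := [Choice of Clifford by <:].

Definition cl_perm (g : Clifford) : {perm phase} := (cl_pair g).1.
Definition cl_fun (g : Clifford) : {ffun phase -> C} := (cl_pair g).2.

Lemma is_cliffordP (T : {perm phase}) (l : {ffun phase -> C}) :
  reflect [/\ forall u v, T (u + v) = T u + T v, forall u, `|l u| = 1 &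
    forall u v, l (u + v) * (l u)^-1 * (l v)^-1 =
      beta (T u) (T v) * (beta u v)^-1] (is_clifford T l).
Proof.
apply: (iffP and3P) => -[].
  move=> /additive_permP aT /forallP l1 /forallP lT; split=> // [u|u v].
    exact/eqP.
  by apply/eqP; move/forallP: (lT u).
move=> aT l1 lT; split; first exact/additive_permP.
  by apply/forallP => u; apply/eqP.
by apply/forallP => u; apply/forallP => v; apply/eqP.
Qed.

Lemma cl_permD g u v : cl_perm g (u + v) = cl_perm g u + cl_perm g v.
Proof. by have /is_cliffordP[] := valP g. Qed.
Lemma cl_norm g u : `|cl_fun g u| = 1.
Proof. by have /is_cliffordP[] := valP g. Qed.
Lemma cl_cocycle g u v :
  cl_fun g (u + v) * (cl_fun g u)^-1 * (cl_fun g v)^-1 =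
  beta (cl_perm g u) (cl_perm g v) * (beta u v)^-1.
Proof. by have /is_cliffordP[] := valP g. Qed.
Lemma cl_neq0 g u : cl_fun g u != 0.
Proof. by rewrite -normr_eq0 cl_norm oner_eq0. Qed.

Lemma cl_funD g u v : cl_fun g (u + v) * beta u v =
  beta (cl_perm g u) (cl_perm g v) * cl_fun g u * cl_fun g v.
Proof.
have := (cl_neq0 g u, cl_neq0 g v, beta_neq0 u v) => -[[u0 v0] b0].
have -> : cl_fun g (u + v) = cl_fun g (u + v) * (cl_fun g u)^-1 *
    (cl_fun g v)^-1 * cl_fun g u * cl_fun g v by field; rewrite u0 v0.
by rewrite cl_cocycle; field.
Qed.

Lemma cl_fun0 g : cl_fun g 0 = 1.
Proof.
have g0 : cl_perm g 0 = 0.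
  by apply: (addrI (cl_perm g 0)); rewrite -cl_permD !addr0.
have := cl_funD g 0 0; rewrite addr0 g0 mulrC -!mulrA => /(mulfI (beta_neq0 0 0)).
by rewrite -[LHS]mulr1 => /(mulfI (cl_neq0 g 0)).
Qed.

Lemma cl_is_sp g : is_sp (cl_perm g).
Proof.
apply/is_spP; split=> [u v|u v]; first exact: cl_permD.
rewrite /omega; have := cl_funD g v u; rewrite [v + u]addrC => Evu.
have [u0 v0] := (cl_neq0 g u, cl_neq0 g v).
have [z0 b0 b0'] := And3 (cl_neq0 g (u + v)) (beta_neq0 u v) (beta_neq0 v u).
have -> : beta (cl_perm g v) (cl_perm g u) =
    cl_fun g (u + v) * beta v u / (cl_fun g v * cl_fun g u).
  by rewrite Evu; field; rewrite u0 v0.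
have -> : beta (cl_perm g u) (cl_perm g v) =
    cl_fun g (u + v) * beta u v / (cl_fun g u * cl_fun g v).
  by rewrite cl_funD; field; rewrite u0 v0.
by field; rewrite ?u0 ?v0 ?z0 ?b0 ?b0'.
Qed.

(* The projection onto the symplectic group. *)
Definition cl_sp (g : Clifford) : Sp := MkSp (cl_is_sp g).

Lemma is_clifford1 : is_clifford 1%g [ffun=> 1].
Proof.
apply/is_cliffordP; split=> [u v|u|u v]; first by rewrite !perm1.
  by rewrite ffunE normr1.
by rewrite !ffunE !perm1 invr1 !mulr1 mulfV ?beta_neq0.
Qed.

Lemma mk_cliffordP (T : {perm phase}) (l : phase -> C) :
  (forall u v, T (u + v) = T u + T v) -> (forall u, `|l u| = 1) ->
  (forall u v, l (u + v) * beta u v = beta (T u) (T v) * l u * l v) ->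
  is_clifford T (finfun l).
Proof.
move=> aT l1 lT; apply/is_cliffordP; split=> // [u|u v]; rewrite !ffunE //.
have l0 w : l w != 0 by rewrite -normr_eq0 l1 oner_eq0.
apply/eqP; rewrite -mulrA -invfM eqr_div ?mulf_neq0 ?beta_neq0 //.
by rewrite lT mulrA.
Qed.

Lemma is_cliffordM (g h : Clifford) : is_clifford (cl_perm h * cl_perm g)%g
  (finfun (fun u => cl_fun g (cl_perm h u) * cl_fun h u)).
Proof.
apply: mk_cliffordP => [u v|u|u v]; first by rewrite !permM !cl_permD.
  by rewrite normrM !cl_norm mulr1.
rewrite !permM -mulrA cl_funD cl_permD.
have E := cl_funD g (cl_perm h u) (cl_perm h v).
transitivity (cl_fun g (cl_perm h u + cl_perm h v) *
  beta (cl_perm h u) (cl_perm h v) * cl_fun h u * cl_fun h v); first by ring.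
by rewrite E; ring.
Qed.

Lemma clV_aux (x y z b b' : C) : x != 0 -> y != 0 -> z != 0 ->
  z * b' = b * x * y -> z^-1 * b = b' * x^-1 * y^-1.
Proof.
move=> x0 y0 z0 E; have -> : b' = b * x * y / z by rewrite -E; field.
by field; rewrite x0 y0 z0.
Qed.

Lemma is_cliffordV (g : Clifford) : is_clifford (cl_perm g)^-1%g
  (finfun (fun u => (cl_fun g ((cl_perm g)^-1%g u))^-1)).
Proof.
have aV u v : (cl_perm g)^-1%g (u + v) =
    (cl_perm g)^-1%g u + (cl_perm g)^-1%g v.
  by apply: (@perm_inj _ (cl_perm g)); rewrite cl_permD !permKV.
apply: mk_cliffordP => // [u|u v]; first by rewrite normfV cl_norm invr1.
set u' := (cl_perm g)^-1%g u; set v' := (cl_perm g)^-1%g v; have := cl_funD g u' v'.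
rewrite !permKV -/u' -/v' aV -/u' -/v'.
move=> E; by apply: clV_aux; rewrite ?cl_neq0.
Qed.


Definition cl_one : Clifford := @MkClifford (_, _) is_clifford1.
Definition cl_mul (g h : Clifford) : Clifford :=
  @MkClifford (_, _) (is_cliffordM g h).
Definition cl_inv (g : Clifford) : Clifford :=
  @MkClifford (_, _) (is_cliffordV g).

Lemma cl_eq (g h : Clifford) :
  cl_perm g =1 cl_perm h -> cl_fun g =1 cl_fun h -> g = h.
Proof.
move=> /permP eT /ffunP el; apply/val_inj.
by rewrite [LHS]surjective_pairing [RHS]surjective_pairing; congr (_, _).
Qed.

Lemma cl_mulA : associative cl_mul.
Proof.
move=> g h k; apply: cl_eq => u; first by rewrite /cl_perm /= mulgA.
by rewrite !ffunE permM mulrA.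
Qed.
Lemma cl_mul1 : left_id cl_one cl_mul.
Proof.
by move=> g; apply: cl_eq => u; rewrite /cl_perm /= ?mulg1 // !ffunE mul1r.
Qed.
Lemma cl_mul1r : right_id cl_one cl_mul.
Proof.
move=> g; apply: cl_eq => u; first by rewrite /cl_perm /= mul1g.
by rewrite !ffunE perm1 mulr1.
Qed.
Lemma cl_mulV : left_inverse cl_one cl_inv cl_mul.
Proof.
move=> g; apply: cl_eq => u; first by rewrite /cl_perm /= mulgV.
by rewrite !ffunE permK mulVf ?cl_neq0.
Qed.
Lemma cl_mulVr : right_inverse cl_one cl_inv cl_mul.
Proof.
move=> g; apply: cl_eq => u; first by rewrite /cl_perm /= mulVg.
by rewrite !ffunE mulfV ?cl_neq0.
Qed.

HB.instance Definition _ :=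
  isGroup.Build Clifford cl_mulA cl_mul1 cl_mul1r cl_mulV cl_mulVr.

Lemma cl_permM (g h : Clifford) u : cl_perm (g * h)%g u = cl_perm g (cl_perm h u).
Proof. exact: permM. Qed.
Lemma cl_funM (g h : Clifford) u :
  cl_fun (g * h)%g u = cl_fun g (cl_perm h u) * cl_fun h u.
Proof. exact: ffunE. Qed.
Lemma cl_fun1 u : cl_fun 1%g u = 1.
Proof. exact: ffunE. Qed.
Lemma cl_sp1 : cl_sp 1%g = 1%g.
Proof. exact/val_inj. Qed.
Lemma cl_spM (g h : Clifford) : cl_sp (g * h)%g = (cl_sp g * cl_sp h)%g.
Proof. exact/val_inj. Qed.
Lemma cl_spE (g : Clifford) u : cl_sp g u = cl_perm g u.
Proof. by []. Qed.

Lemma aspM (g h : ASp) : (g * h)%g = asp_mul g h. Proof. by []. Qed.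

End CliffordGroup.

Arguments beta {C A} u v.
Arguments omega {C A} u v.

Section FunctorF.
Variables (C : numClosedFieldType) (A : finZmodType).
Local Notation V := (phase C A).
Local Notation ASp := (ASp C A).
Local Notation Clifford := (Clifford C A).
Implicit Types (U W X : rep C ASp) (v w : V).

Definition asp_of_sp (T : Sp C A) : ASp := MkASp T 0.
Definition asp_of_char (f : dual C V) : ASp := MkASp 1%g f.

(* U_v *)
Definition weight U v : {vspace U} :=
  (\bigcap_(f : dual C V) lker (rep_act U (asp_of_char f) - f v *: \1%VF))%VS.

Lemma weightP U v (x : U) :
  reflect (forall f : dual C V, rep_act U (asp_of_char f) x = f v *: x)
    (x \in weight U v).
Proof.
rewrite /weight; apply: (iffP idP) => [H f|H].
  have := subvP (bigcapv_inf f (erefl true) (subvv _)) x H.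
  rewrite memv_ker add_lfunE opp_lfunE scale_lfunE id_lfunE subr_eq0.
  by move/eqP.
rewrite memvE; apply/subv_bigcapP => f _; rewrite -memvE memv_ker.
by rewrite add_lfunE opp_lfunE scale_lfunE id_lfunE H subrr.
Qed.

Definition rho U (T : Sp C A) : 'End(U) := rep_act U (asp_of_sp T).

(* The projection of U, the direct sum of the U_v, onto U_v; see [wproj_in],
   [wproj_weight] and [wproj_sum]. *)
Definition wproj U v : 'End(U) :=
  #|{: dual C V}|%:R^-1 *:
    \sum_(f : dual C V) (f v)^-1 *: rep_act U (asp_of_char f).

Lemma wprojE U v x : wproj U v x = #|{: dual C V}|%:R^-1 *:
  \sum_(f : dual C V) (f v)^-1 *: rep_act U (asp_of_char f) x.
Proof.
rewrite scale_lfunE sum_lfunE; congr (_ *: _).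
by apply: eq_bigr => f _; rewrite scale_lfunE.
Qed.

Lemma act_charD U f h :
  rep_act U (asp_of_char (f + h)) =
  (rep_act U (asp_of_char f) \o rep_act U (asp_of_char h))%VF.
Proof.
rewrite -rep_actM; congr (rep_act U _); apply: asp_eq => [|v] /=.
  by rewrite mulg1.
by rewrite !dual_addE sp_pullE sp1E.
Qed.

Lemma card_dual_neq0 : #|{: dual C V}|%:R != 0 :> C.
Proof. by rewrite pnatr_eq0 -lt0n; apply/card_gt0P; exists 0. Qed.

Lemma wproj_in U v x : wproj U v x \in weight U v.
Proof.
apply/weightP => f; rewrite wprojE linearZ /= scalerA mulrC -scalerA.
congr (_ *: _); rewrite linear_sum scaler_sumr /=.
rewrite [RHS](reindex_inj (addrI f)) /=; apply: eq_bigr => h _.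
rewrite linearZ /= act_charD comp_lfunE scalerA dual_addE invfM.
by rewrite mulVKf ?dual_neq0.
Qed.

Lemma wproj_weight U v w x : x \in weight U w ->
  wproj U v x = if v == w then x else 0.
Proof.
move=> /weightP xw; rewrite wprojE.
transitivity (#|{: dual C V}|%:R^-1 *: (\sum_(f : dual C V) f (w - v) *: x)).
  congr (_ *: _); apply: eq_bigr => f _.
  by rewrite xw scalerA dualD dualN mulrC.
rewrite -scaler_suml sum_dual_arg subr_eq0 eq_sym.
case: eqP => _; last by rewrite scale0r scaler0.
by rewrite scalerA mulVf ?card_dual_neq0 // scale1r.
Qed.

Lemma wproj_id U v x : x \in weight U v -> wproj U v x = x.
Proof. by move=> xv; rewrite (wproj_weight _ xv) eqxx. Qed.

Lemma act_char0 U : rep_act U (asp_of_char 0) = \1%VF.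
Proof. exact: rep_act1. Qed.

Lemma wproj_sum U x : \sum_v wproj U v x = x.
Proof.
transitivity (\sum_v #|{: dual C V}|%:R^-1 *:
  (\sum_(f : dual C V) (f v)^-1 *: rep_act U (asp_of_char f) x)).
  by apply: eq_bigr => v _; rewrite wprojE.
rewrite -scaler_sumr exchange_big /=.
transitivity (#|{: dual C V}|%:R^-1 *: \sum_(f : dual C V)
   (if f == 0 then #|{: V}|%:R else 0) *: rep_act U (asp_of_char f) x).
  congr (_ *: _); apply: eq_bigr => f _; rewrite -scaler_suml; congr (_ *: _).
  rewrite -oppr_eq0 -sum_dual; apply: eq_bigr => v _; by rewrite dual_oppE.
rewrite (bigD1 0) //= big1 => [|f /negPf f0]; last by rewrite f0 scale0r.
rewrite eqxx addr0 act_char0 id_lfunE scalerA card_dual mulVf ?scale1r //.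
by rewrite -(@card_dual C) card_dual_neq0.
Qed.

Lemma weight_ext U (Y : vectType C) (f g : 'Hom(U, Y)) :
  (forall v x, x \in weight U v -> f x = g x) -> f = g.
Proof.
move=> fg; apply/lfunP => x; rewrite -(wproj_sum x) !linear_sum.
by apply: eq_bigr => v _ /=; rewrite (fg v) ?wproj_in.
Qed.

Lemma rho_weight U T v x : x \in weight U v -> rho U T x \in weight U (T v).
Proof.
move=> /weightP xv; apply/weightP => f; rewrite /rho -comp_lfunE -rep_actM.
have -> : (asp_of_char f * asp_of_sp T)%g =
    (asp_of_sp T * asp_of_char (sp_pull f T))%g.
  apply: asp_eq => [|u] /=; first by rewrite mul1g mulg1.
  by rewrite !dual_addE !sp_pullE !dual_zeroE mul1r mulr1.
by rewrite rep_actM comp_lfunE xv sp_pullE linearZ.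
Qed.

Lemma rhoM U T S x : rho U (T * S)%g x = rho U T (rho U S x).
Proof.
rewrite /rho -comp_lfunE -rep_actM; congr (rep_act U _ x).
by apply: asp_eq => [|u] //=; rewrite dual_addE sp_pullE !dual_zeroE mulr1.
Qed.

Lemma rho1 U x : rho U 1%g x = x.
Proof. by rewrite /rho (_ : asp_of_sp 1%g = 1%g) // rep_act1 id_lfunE. Qed.

Lemma act_weight U (g : ASp) v x : x \in weight U v ->
  rep_act U g x = asp_char g v *: rho U (asp_lin g) x.
Proof.
move=> /weightP xv.
have -> : g = (asp_of_sp (asp_lin g) * asp_of_char (asp_char g))%g.
  apply: asp_eq => [|u] /=; first by rewrite mulg1.
  by rewrite dual_addE sp_pullE dual_zeroE mul1r.
rewrite rep_actM comp_lfunE xv linearZ /= mulg1 /rho; congr (_ *: _).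
by rewrite dual_addE sp_pullE dual_zeroE mul1r.
Qed.

(* Characterized by [F_act_weight]. *)
Definition F_act U (g : Clifford) : 'End(U) :=
  \sum_v cl_fun g v *: (rho U (cl_sp g) \o wproj U v)%VF.

Lemma F_act_weight U g v x : x \in weight U v ->
  F_act U g x = cl_fun g v *: rho U (cl_sp g) x.
Proof.
move=> xv; rewrite sum_lfunE (bigD1 v) //= big1 ?addr0 => [|w /negPf wv].
  by rewrite scale_lfunE comp_lfunE wproj_id.
by rewrite scale_lfunE comp_lfunE (wproj_weight w xv) wv !linear0.
Qed.

Lemma F_act1 U : F_act U 1%g = \1%VF.
Proof.
apply: weight_ext => v x xv; rewrite (F_act_weight _ xv) cl_fun1 cl_sp1 rho1.
by rewrite scale1r id_lfunE.
Qed.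

Lemma F_actM U g h : F_act U (g * h)%g = (F_act U g \o F_act U h)%VF.
Proof.
apply: weight_ext => v x xv; rewrite comp_lfunE !(F_act_weight _ xv) linearZ.
rewrite /= (F_act_weight _ (rho_weight (cl_sp h) xv)) cl_funM cl_spM rhoM.
by rewrite scalerA mulrC.
Qed.

Definition F_ob U : rep C Clifford := Rep (@F_act1 U) (@F_actM U).

Lemma hom_weight U W (f : rep_hom U W) v x :
  x \in weight U v -> f x \in weight W v.
Proof.
by move=> /weightP xv; apply/weightP => k; rewrite -rep_homE xv linearZ.
Qed.

Lemma F_mor_proof U W (f : rep_hom U W) g x :
  f (rep_act (F_ob U) g x) = rep_act (F_ob W) g (f x).
Proof.
rewrite /= -!comp_lfunE; congr (fun_of_lfun _ x).
apply: weight_ext => v y yv; rewrite !comp_lfunE (F_act_weight _ yv).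
by rewrite (F_act_weight _ (hom_weight f yv)) linearZ /= /rho rep_homE.
Qed.

(* The same linear map. *)
Definition F_mor U W (f : rep_hom U W) : rep_hom (F_ob U) (F_ob W) :=
  @mk_rep_hom C Clifford (F_ob U) (F_ob W) f (@F_mor_proof U W f).

(* For b bilinear, characterized by [wlift_weight]. *)
Definition wlift U W (Y : vectType C) (k : V -> V -> C) (b : U -> W -> Y) :
    'Hom(tens U W, Y) :=
  tlift (fun x y => \sum_v \sum_w k v w *: b (wproj U v x) (wproj W w y)).

Lemma wlift_weight U W (Y : vectType C) k (b : U -> W -> Y) v w x y : bilin b ->
  x \in weight U v -> y \in weight W w ->
  wlift k b (tensv x y) = k v w *: b x y.
Proof.
move=> bb xv yw; rewrite tlift_tensv; last first.
  apply: bilin_bigsum => v'; apply: bilin_bigsum => w'; apply: bilin_scale.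
  exact: bilin_map.
have [bl br] := bb.
have b0l z : b 0 z = 0.
  by have := bl z (-1) 0 0; rewrite scaleN1r oppr0 addr0 scaleN1r addNr.
have b0r z : b z 0 = 0.
  by have := br z (-1) 0 0; rewrite scaleN1r oppr0 addr0 scaleN1r addNr.
rewrite (bigD1 v) //= [X in _ + X]big1 ?addr0 => [|v' /negPf v'v]; last first.
  apply: big1 => w' _; by rewrite (wproj_weight _ xv) v'v b0l scaler0.
rewrite (bigD1 w) //= big1 ?addr0 => [|w' /negPf w'w]; last first.
  by rewrite (wproj_weight _ yw) w'w b0r scaler0.
by rewrite !wproj_id.
Qed.

Lemma weight_ext2 U W (Y : vectType C) (f g : 'Hom(tens U W, Y)) :
  (forall v w x y, x \in weight U v -> y \in weight W w ->
     f (tensv x y) = g (tensv x y)) -> f = g.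
Proof.
move=> fg; apply: tens_ext => x y.
have -> : tensv x y = \sum_v \sum_w tensv (wproj U v x) (wproj W w y).
  transitivity (tensv (\sum_v (1 : C) *: wproj U v x)
                      (\sum_w (1 : C) *: wproj W w y)).
    by congr tensv; rewrite -[LHS]wproj_sum; apply: eq_bigr => v _;
      rewrite scale1r.
  rewrite (bilin_sum (@tensv_bilin C U W)); apply: eq_bigr => v _.
  by apply: eq_bigr => w _; rewrite mulr1 scale1r.
rewrite !linear_sum; apply: eq_bigr => v _; rewrite !linear_sum.
by apply: eq_bigr => w _ /=; rewrite (fg v w) ?wproj_in.
Qed.

Lemma tens_weight U W v w (x : U) (y : W) :
  x \in weight U v -> y \in weight W w ->
  tensv x y \in weight (rep_tens U W) (v + w).
Proof.
move=> /weightP xv /weightP yw; apply/weightP => f.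
by rewrite rep_tensE xv yw tensvZl tensvZr scalerA dualD.
Qed.

Lemma rho_tens U W T (x : U) (y : W) :
  rho (rep_tens U W) T (tensv x y) = tensv (rho U T x) (rho W T y).
Proof. exact: rep_tensE. Qed.

(* J, characterized by [F_tens_mapE]. *)
Definition F_tens_map U W : 'Hom(tens U W, tens U W) :=
  wlift beta (@tensv C U W).

Lemma F_tens_mapE U W v w x y : x \in weight U v -> y \in weight W w ->
  F_tens_map U W (tensv x y) = beta v w *: tensv x y.
Proof. by move=> xv yw; apply: wlift_weight xv yw; apply: tensv_bilin. Qed.

Lemma F_tens_proof U W g x :
  F_tens_map U W (rep_act (rep_tens (F_ob U) (F_ob W)) g x) =
  rep_act (F_ob (rep_tens U W)) g (F_tens_map U W x).
Proof.
rewrite -!comp_lfunE; congr (fun_of_lfun _ x).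
apply: (@weight_ext2 U W) => v w y z yv zw.
rewrite !comp_lfunE (F_tens_mapE yv zw) (@rep_tensE C Clifford (F_ob U) (F_ob W)).
rewrite /= (F_act_weight _ yv) (F_act_weight _ zw) tensvZl tensvZr !linearZ /=.
rewrite (F_tens_mapE (rho_weight _ yv) (rho_weight _ zw)).
rewrite (F_act_weight _ (tens_weight yv zw)) rho_tens !scalerA; congr (_ *: _).
by rewrite [RHS]mulrC cl_funD !cl_spE; ring.
Qed.

Definition F_tens U W :
    rep_hom (rep_tens (F_ob U) (F_ob W)) (F_ob (rep_tens U W)) :=
  @mk_rep_hom C Clifford (rep_tens (F_ob U) (F_ob W)) (F_ob (rep_tens U W))
    (F_tens_map U W) (@F_tens_proof U W).

Lemma unit_weight (x : rep_unit C ASp) : x \in weight (rep_unit C ASp) 0.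
Proof. by apply/weightP => f; rewrite /= id_lfunE dual0 scale1r. Qed.

Lemma F_unit_proof g (x : rep_unit C Clifford) :
  (\1%VF : 'Hom(rep_unit C Clifford, F_ob (rep_unit C ASp)))
    (rep_act (rep_unit C Clifford) g x) =
  rep_act (F_ob (rep_unit C ASp)) g
   ((\1%VF : 'Hom(rep_unit C Clifford, F_ob (rep_unit C ASp))) x).
Proof.
rewrite /= !id_lfunE (F_act_weight _ (unit_weight x)) cl_fun0 scale1r.
by rewrite /rho /= id_lfunE.
Qed.

Definition F_unit : rep_hom (rep_unit C Clifford) (F_ob (rep_unit C ASp)) :=
  @mk_rep_hom C Clifford (rep_unit C Clifford) (F_ob (rep_unit C ASp)) \1%VF
    F_unit_proof.

Definition F_functor :
    tensor_functor (Rep_tensor_cat C ASp) (Rep_tensor_cat C Clifford) :=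
  @TensorFunctor C (Rep_tensor_cat C ASp) (Rep_tensor_cat C Clifford)
    F_ob F_mor F_tens F_unit.

(* c^omega, characterized by [comega_mapE]. *)
Definition comega_map U W : 'Hom(tens U W, tens W U) :=
  wlift (fun v w => omega w v) (fun x y => tensv y x).

Lemma comega_mapE U W v w x y : x \in weight U v -> y \in weight W w ->
  comega_map U W (tensv x y) = omega w v *: tensv y x.
Proof.
move=> xv yw; apply: (wlift_weight _ _ xv yw).
exact/bilin_flip/tensv_bilin.
Qed.

Lemma comega_proof U W g x :
  comega_map U W (rep_act (rep_tens U W) g x) =
  rep_act (rep_tens W U) g (comega_map U W x).
Proof.
rewrite -!comp_lfunE; congr (fun_of_lfun _ x).
apply: (@weight_ext2 U W) => v w y z yv zw.
rewrite !comp_lfunE (comega_mapE yv zw) (@rep_tensE C ASp U W).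
rewrite linearZ /= (@rep_tensE C ASp W U).
rewrite (act_weight g yv) (act_weight g zw) tensvZl !tensvZr tensvZl !linearZ /=.
rewrite (comega_mapE (rho_weight _ yv) (rho_weight _ zw)) sp_omega !scalerA.
by congr (_ *: _); ring.
Qed.

Definition comega U W : rep_hom (rep_tens U W) (rep_tens W U) :=
  @mk_rep_hom C ASp (rep_tens U W) (rep_tens W U) (comega_map U W)
    (@comega_proof U W).

(* Rep(ASp(A)) with c^omega in place of the flip. *)
Definition Rep_omega : symmetric_tensor_cat C :=
  @SymmetricTensorCat C (Rep_tensor_cat C ASp) comega.

End FunctorF.

(* Main.v *)
Require Import Defs.
From HB Require Import structures.
From mathcomp Require Import all_boot all_order all_algebra.
From mathcomp Require Import fingroup perm spectral.
From mathcomp Require Import boolp ring.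
From mathcomp Require Import reals complex.

(** Why the theorem holds.  Restricted to the translations (id, chi), a
    representation of either ASp(A) or C(A) is a representation of the character
    group of V_A, hence a direct sum of weight spaces indexed by V_A.  On
    vectors of weight v, the two groups act in the same way up to the scalar
    lambda(v), and F multiplies by that scalar.  The inverse functor G
    divides by it: (T, chi) acts on a vector of weight v of a representation
    of C(A) by chi(v) lambda(v)^-1 (T, lambda), for any lift (T, lambda) of T.
    Two facts make G well defined.

    - Two lifts of T differ by a translation (id, f), and f(v) = lambda'(v) /
      lambda(v) is exactly the factor by which the actions of the two lifts
      on weight v differ ([cl_same_sp]); so the choice does not matter, and
      choosing the product of two lifts as a lift of the product shows that
      the formula defines an action ([G_act_weight], [G_actM]).

    - Every symplectic T has a lift ([cl_sp_surj]).  The bicharacter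
      b(u, v) = beta(Tu, Tv) / beta(u, v) is symmetric because T preserves
      omega, and a symmetric bicharacter is a coboundary: the twisted group
      algebra of V_A with multiplication e_u e_v = b(u, v) e_(u + v) is
      commutative, so its regular representation has a common eigenvector,
      whose eigenvalues m satisfy m(u) m(v) = b(u, v) m(u + v)
      ([symmetric_bicharacter_trivial]).

    The tensor structures are beta for F and beta^-1 for G.  All tensor axioms
    are equalities of linear maps out of iterated tensor products; weight
    vectors span, so each of them is an identity between scalars.
    Bimultiplicativity of beta gives associativity, and
    omega(w, v) beta(v, w) = beta(w, v) turns the flip into c^omega.

    F and G do not change the underlying spaces and linear maps, and their
    composites give back the same actions ([G_F_act], [F_G_act]).  That
    the composites are equal to the identity as tensor functors, and not merely
    isomorphic to it, then follows from extensionality and proof irrelevance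
    ([strict_id_rep_functor]). *)

Set Implicit Arguments.
Unset Strict Implicit.
Unset Printing Implicit Defensive.

Import Order.TTheory GRing.Theory Num.Theory.
Local Open Scope ring_scope.

(** * Linear maps on tensor products and the tensor category of representations *)

Section TensorExtensionality.
Variable k : fieldType.
Implicit Types T U V W X : vectType k.

(** The consequence of S spanning T that is needed; unlike spanning, it passes to
    tensor products without any manipulation of linear combinations. *)
Definition separating T X (S : T -> Prop) : Prop :=
  forall f g : 'Hom(T, X), (forall t, S t -> f t = g t) -> f = g.

(** If S spans T and S' spans W, the tensors of their elements span the tensor
    product: with one factor fixed, both sides are linear in the other one.
    The extensionality principles below, for three or four factors and for
    weight vectors, are all instances. *)
Lemma separating_tens T W X (S : T -> Prop) (S' : W -> Prop) :
  separating X S -> separating X S' ->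
  forall f g : 'Hom(tens T W, X),
  (forall t w, S t -> S' w -> f (tensv t w) = g (tensv t w)) -> f = g.
Proof.
move=> sepS sepS' f g fg; apply: tens_ext => t w.
pose L w : {linear T -> tens T W} := HB.pack
  (fun t => tensv t w)
  (GRing.isLinear.Build _ _ _ _ _ ((tensv_bilin T W).1 w)).
pose M t : {linear W -> tens T W} := HB.pack
  (fun w => tensv t w)
  (GRing.isLinear.Build _ _ _ _ _ ((tensv_bilin T W).2 t)).
have LE s w' : tensv s w' = linfun (L w') s by rewrite lfunE.
have ME t' s : tensv t' s = linfun (M t') s by rewrite lfunE.
rewrite LE -!comp_lfunE; congr (fun_of_lfun _ t); apply: sepS => {}t St.
rewrite !comp_lfunE -!LE ME -!comp_lfunE; congr (fun_of_lfun _ w).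
by apply: sepS' => {}w Sw; rewrite !comp_lfunE -!ME fg.
Qed.

Lemma separating_true T X : @separating T X (fun=> True).
Proof. by move=> f g fg; apply/lfunP => t; apply: fg. Qed.

Lemma lfun_cancel U W (f : 'Hom(U, W)) (g : 'Hom(W, U)) :
  (g \o f)%VF = \1%VF -> cancel f g.
Proof. by move=> gf x; rewrite -comp_lfunE gf id_lfunE. Qed.

End TensorExtensionality.

Section RepTensor.
Variables (k : fieldType) (G : groupType).
Local Notation Rep := (Rep_tensor_cat k G).
Implicit Types U V W X : rep k G.

Lemma rep_hom_eq U W (f g : rep_hom U W) : f =1 g -> f = g.
Proof. by move=> fg; apply/val_inj/lfunP. Qed.

(** The linear inverse of an intertwiner is an intertwiner, so isomorphisms of
    representations can be checked on the underlying linear maps. *)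
Lemma rep_isoP U W (f : rep_hom U W) (g : 'Hom(W, U)) :
  cancel f g -> cancel g f -> @is_iso k Rep U W f.
Proof.
move=> fK gK.
have gP h x : g (rep_act W h x) = rep_act U h (g x).
  by rewrite -{1}(gK x) -rep_homE fK.
exists (mk_rep_hom gP); split; apply: rep_hom_eq => x /=.
  by rewrite comp_lfunE id_lfunE fK.
by rewrite comp_lfunE id_lfunE gK.
Qed.

Lemma tens_ext3r U V W X (f g : 'Hom(tens U (tens V W), X)) :
  (forall u v w, f (tensv u (tensv v w)) = g (tensv u (tensv v w))) -> f = g.
Proof.
move=> fg; apply: (@separating_tens k U (tens V W) X (fun=> True)
  (fun t => exists (v : V) (w : W), t = tensv v w)).
- exact: separating_true.
- by move=> h h' hh; apply: tens_ext => v w; apply: hh; exists v, w.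
by move=> u _ _ [v [w ->]].
Qed.

Lemma tens_ext4 U V W X (Y : vectType k)
    (f g : 'Hom(tens (tens (tens U V) W) X, Y)) :
  (forall u v w x, f (tensv (tensv (tensv u v) w) x) =
                   g (tensv (tensv (tensv u v) w) x)) -> f = g.
Proof.
move=> fg; apply: (@separating_tens k (tens (tens U V) W) X Y
  (fun t => exists (u : U) (v : V) (w : W), t = tensv (tensv u v) w)
  (fun=> True)).
- by move=> h h' hh; apply: tens_ext3 => u v w; apply: hh; exists u, v, w.
- exact: separating_true.
by move=> _ x [u [v [w ->]]].
Qed.

(** Reversing the order of the three factors, by flips, exchanges the two ways
    to bracket them; hence the inverse of the associator is the associator of
    the reversed product, conjugated by these reversals. *)
Definition tassocV U V W : 'Hom(tens U (tens V W), tens (tens U V) W) :=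
  (tmap (tflip V U) \1 \o tflip W (tens V U) \o tassoc W V U \o
   tmap (tflip V W) \1 \o tflip U (tens V W))%VF.

Lemma tassocVE U V W (u : U) (v : V) (w : W) :
  tassocV U V W (tensv u (tensv v w)) = tensv (tensv u v) w.
Proof.
by rewrite !comp_lfunE tflipE tmapE tflipE id_lfunE tassocE tflipE tmapE
  tflipE id_lfunE.
Qed.

Lemma Rep_is_tensor_category : is_tensor_category Rep.
Proof.
split.
- by move=> X Y Z W f g h; apply/val_inj; rewrite /= comp_lfunA.
- by move=> X Y f; apply/val_inj; rewrite /= comp_lfun1l.
- by move=> X Y f; apply/val_inj; rewrite /= comp_lfun1r.
- move=> X Y Z g a f f'; apply: rep_hom_eq => x.
  by rewrite /= !(comp_lfunE, add_lfunE, scale_lfunE).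
- move=> X Y Z f a g g'; apply: rep_hom_eq => x.
  by rewrite /= !(comp_lfunE, add_lfunE, scale_lfunE) linearP.
- move=> X Y; apply/val_inj/tens_ext => x y /=.
  by rewrite tmapE !id_lfunE.
- move=> X X' X'' Y Y' Y'' f' f g' g; apply/val_inj/tens_ext => x y /=.
  by rewrite comp_lfunE !tmapE !comp_lfunE.
- move=> X X' Y Y' g a f f'; apply/val_inj/tens_ext => x y /=.
  by rewrite !(add_lfunE, scale_lfunE) !tmapE !(add_lfunE, scale_lfunE)
    tensvDl tensvZl.
- move=> X X' Y Y' f a g g'; apply/val_inj/tens_ext => x y /=.
  by rewrite !(add_lfunE, scale_lfunE) !tmapE !(add_lfunE, scale_lfunE)
    tensvDr tensvZr.
- move=> X Y Z; apply: (@rep_isoP _ _ (rep_assoc X Y Z) (tassocV X Y Z));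
    apply: lfun_cancel.
    apply: tens_ext3 => x y z /=.
    by rewrite comp_lfunE tassocE tassocVE id_lfunE.
  apply: tens_ext3r => x y z /=.
  by rewrite comp_lfunE tassocVE tassocE id_lfunE.
- move=> X.
  have l1 : linear (fun x : X => tensv (1 : k^o) x).
    by move=> a x y; rewrite tensvDr tensvZr.
  pose L : {linear X -> tens k^o X} :=
    HB.pack (fun x : X => tensv (1 : k^o) x) (GRing.isLinear.Build _ _ _ _ _ l1).
  have LE x : linfun L x = tensv (1 : k^o) x by rewrite lfunE.
  apply: (@rep_isoP _ _ (rep_lunit X) (linfun L)); apply: lfun_cancel.
    apply: tens_ext => a x /=; rewrite comp_lfunE tlunitE LE id_lfunE.
    by rewrite tensvZr -tensvZl /GRing.scale /= mulr1.
  by apply/lfunP => x; rewrite comp_lfunE LE tlunitE id_lfunE scale1r.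
- move=> X.
  have l1 : linear (fun x : X => tensv x (1 : k^o)).
    by move=> a x y; rewrite tensvDl tensvZl.
  pose L : {linear X -> tens X k^o} :=
    HB.pack (fun x : X => tensv x (1 : k^o)) (GRing.isLinear.Build _ _ _ _ _ l1).
  have LE x : linfun L x = tensv x (1 : k^o) by rewrite lfunE.
  apply: (@rep_isoP _ _ (rep_runit X) (linfun L)); apply: lfun_cancel.
    apply: tens_ext => x a /=; rewrite comp_lfunE trunitE LE id_lfunE.
    by rewrite tensvZl -tensvZr /GRing.scale /= mulr1.
  by apply/lfunP => x; rewrite comp_lfunE LE trunitE id_lfunE scale1r.
- move=> X X' Y Y' Z Z' f g h; apply/val_inj/tens_ext3 => x y z /=.
  by rewrite !comp_lfunE !(tmapE, tassocE).
- move=> X X' f; apply/val_inj/tens_ext => a x /=.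
  by rewrite !comp_lfunE tmapE !tlunitE id_lfunE linearZ.
- move=> X X' f; apply/val_inj/tens_ext => x a /=.
  by rewrite !comp_lfunE tmapE !trunitE id_lfunE linearZ.
- move=> X Y Z W; apply/val_inj/tens_ext4 => x y z w /=.
  by rewrite !comp_lfunE !(tmapE, tassocE, id_lfunE).
- move=> X Y; apply/val_inj/tens_ext3 => x a y /=.
  by rewrite !comp_lfunE !(tmapE, tassocE, id_lfunE, tlunitE, trunitE)
    tensvZl tensvZr.
Qed.

Lemma Rep_is_symmetric_tensor_category :
  is_symmetric_tensor_category (Rep_symmetric k G).
Proof.
split.
- exact: Rep_is_tensor_category.
- move=> X X' Y Y' f g; apply/val_inj/tens_ext => x y /=.
  by rewrite !comp_lfunE !(tmapE, tflipE).
- move=> X Y; apply/val_inj/tens_ext => x y /=.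
  by rewrite !comp_lfunE !tflipE id_lfunE.
- move=> X Y Z; apply/val_inj/tens_ext3 => x y z /=.
  by rewrite !comp_lfunE !(tmapE, tassocE, tflipE, id_lfunE).
Qed.

End RepTensor.

(** * Weight vectors in tensor products, the symmetry and the functor F *)

Section Twist.
Variables (C : numClosedFieldType) (A : finZmodType).
Local Notation V := (phase C A).
Local Notation ASp := (ASp C A).
Implicit Types (U W X : rep C ASp) (v w : V).

Lemma weight_ext3 U W X (Y : vectType C) (f g : 'Hom(tens (tens U W) X, Y)) :
  (forall u v w x y z,
     x \in weight U u -> y \in weight W v -> z \in weight X w ->
     f (tensv (tensv x y) z) = g (tensv (tensv x y) z)) -> f = g.
Proof.
move=> fg; apply: (@separating_tens _ (tens U W) X Y
  (fun t => exists u v (x : U) (y : W),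
     [/\ x \in weight U u, y \in weight W v & t = tensv x y])
  (fun z => exists w, z \in weight X w)).
- move=> h h' hh; apply: (@weight_ext2 _ _ U W) => u v x y xu yv; apply: hh.
  by exists u, v, x, y.
- by move=> h h' hh; apply: weight_ext => w z zw; apply: hh; exists w.
by move=> _ z [u [v [x [y [xu yv ->]]]]] [w zw]; apply: fg xu yv zw.
Qed.

(** The tensor structures of F and of its inverse are of this form, with k equal
    to beta and to its pointwise inverse. *)
Definition twist U W (k : V -> V -> C) : 'End(tens U W) := wlift k (@tensv C U W).

Lemma twistE U W k v w x y : x \in weight U v -> y \in weight W w ->
  twist U W k (tensv x y) = k v w *: tensv x y.
Proof. by move=> xv yw; apply: wlift_weight xv yw; apply: tensv_bilin. Qed.

(** On weight vectors the two maps are multiplications by inverse scalars. *)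
Lemma twistK U W k : (forall v w, k v w != 0) ->
  cancel (twist U W k) (twist U W (fun v w => (k v w)^-1)).
Proof.
move=> k0; apply: lfun_cancel; apply: (@weight_ext2 _ _ U W) => v w x y xv yw.
rewrite comp_lfunE (twistE _ xv yw) linearZ /= (twistE _ xv yw) id_lfunE.
by rewrite scalerA mulfV ?scale1r.
Qed.

Lemma beta0r v : @beta C A v 0 = 1. Proof. exact: dual0. Qed.
Lemma beta0l v : @beta C A 0 v = 1. Proof. exact: dual_zeroE. Qed.

Lemma F_tens_iso U W :
  @is_iso C (Rep_tensor_cat C (Clifford C A)) _ _ (F_tens U W).
Proof.
apply: (@rep_isoP C _ _ _ (F_tens U W) (twist U W (fun v w => (beta v w)^-1))).
  exact: (@twistK U W beta) (@beta_neq0 C A).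
move=> x; rewrite -{2}[x](@twistK U W (fun v w => (beta v w)^-1)); last first.
  by move=> v w; rewrite invr_eq0 beta_neq0.
congr (fun_of_lfun _ _); apply: (@weight_ext2 _ _ U W) => {x} v w x y xv yw.
by rewrite (F_tens_mapE xv yw) (twistE _ xv yw) invrK.
Qed.

(** For the symmetry, omega(v, w) omega(w, v) = 1; for the hexagon, omega is
    multiplicative in its first argument. *)
Lemma Rep_omega_is_symmetric_tensor_category :
  is_symmetric_tensor_category (Rep_omega C A).
Proof.
split.
- exact: Rep_is_tensor_category.
- move=> X X' Y Y' f g; apply/val_inj/(@weight_ext2 _ _ X Y) => v w x y xv yw /=.
  rewrite !comp_lfunE tmapE (comega_mapE xv yw).
  by rewrite (comega_mapE (hom_weight f xv) (hom_weight g yw)) linearZ /= tmapE.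
- move=> X Y; apply/val_inj/(@weight_ext2 _ _ X Y) => v w x y xv yw /=.
  rewrite !comp_lfunE (comega_mapE xv yw) linearZ /= (comega_mapE yw xv).
  rewrite id_lfunE scalerA /omega -[RHS]scale1r; congr (_ *: _).
  by field; rewrite !beta_neq0.
- move=> X Y Z; apply/val_inj/(@weight_ext3 X Y Z) => u v w x y z xu yv zw /=.
  rewrite !comp_lfunE tmapE (comega_mapE xu yv) id_lfunE tassocE.
  rewrite (comega_mapE xu (tens_weight yv zw)) linearZ /= tassocE.
  rewrite tensvZl !linearZ /= tassocE tmapE (comega_mapE xu zw) id_lfunE.
  rewrite tensvZr scalerA; congr (_ *: _); rewrite /omega betaDl betaDr.
  by field; rewrite !beta_neq0.
Qed.

(** The hexagon of J is the 2-cocycle identity for beta, and the two unit axioms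
    hold because the unit object has weight 0, where beta is trivial. *)
Lemma F_is_tensor_functor : is_tensor_functor (F_functor C A).
Proof.
split.
- by move=> X; apply/val_inj.
- by move=> X Y Z f g; apply/val_inj.
- by move=> X Y a f g; apply/val_inj.
- exact: F_tens_iso.
- by apply: (@rep_isoP _ _ _ _ (F_unit C A) \1%VF) => x /=; rewrite !id_lfunE.
- move=> X X' Y Y' f g; apply/val_inj/(@weight_ext2 _ _ X Y) => v w x y xv yw /=.
  rewrite !comp_lfunE (F_tens_mapE xv yw) tmapE linearZ /= tmapE.
  exact: (F_tens_mapE (hom_weight f xv) (hom_weight g yw)).
- move=> X Y Z; apply/val_inj/(@weight_ext3 X Y Z) => u v w x y z xu yv zw /=.
  rewrite !comp_lfunE tassocE !tmapE !id_lfunE (F_tens_mapE xu yv).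
  rewrite (F_tens_mapE yv zw) tensvZr tensvZl !linearZ /=.
  rewrite (F_tens_mapE (tens_weight xu yv) zw).
  rewrite (F_tens_mapE xu (tens_weight yv zw)) linearZ /= tassocE !scalerA.
  by congr (_ *: _); rewrite betaDl betaDr; ring.
- move=> X; apply/val_inj/(@weight_ext2 _ _ (rep_unit C ASp) X).
  move=> u v a x au xv /=.
  rewrite !comp_lfunE tmapE !id_lfunE (F_tens_mapE (unit_weight a) xv).
  by rewrite beta0l scale1r.
- move=> X; apply/val_inj/(@weight_ext2 _ _ X (rep_unit C ASp)).
  move=> u v x a xu av /=.
  rewrite !comp_lfunE tmapE !id_lfunE (F_tens_mapE xu (unit_weight a)).
  by rewrite beta0r scale1r.
Qed.

Lemma F_is_symmetric_tensor_functor :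
  @is_symmetric_tensor_functor C (Rep_omega C A)
    (Rep_symmetric C (Clifford C A)) (F_functor C A).
Proof.
split; first exact: F_is_tensor_functor.
move=> X Y; apply/val_inj/(@weight_ext2 _ _ X Y) => v w x y xv yw /=.
rewrite !comp_lfunE (F_tens_mapE xv yw) linearZ /= (comega_mapE xv yw) tflipE.
rewrite (F_tens_mapE yw xv) scalerA; congr (_ *: _); rewrite /omega.
by field; rewrite beta_neq0.
Qed.

End Twist.

(** * Lifting symplectic maps to Clifford elements *)

Section Trivialize.
Variables (C : numClosedFieldType) (V : finZmodType).

(** A symmetric bicharacter is a coboundary: m = l^-1 is a character of the
    commutative twisted group algebra of V, obtained from a common eigenvector
    of its regular representation. *)
Lemma symmetric_bicharacter_trivial (b : V -> V -> C) :
  (forall u v w, b (u + v) w = b u w * b v w) ->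
  (forall u v, b u v = b v u) -> (forall u v, `|b u v| = 1) ->
  exists2 l : V -> C, (forall u, `|l u| = 1) &
    forall u v, l (u + v) = b u v * l u * l v.
Proof.
move=> bDl bC b1.
have bDr u v w : b u (v + w) = b u v * b u w by rewrite bC bDl bC (bC w).
have b_neq0 u v : b u v != 0 by rewrite -normr_eq0 b1 oner_eq0.
have b0 u : b 0 u = 1.
  by apply: (mulfI (b_neq0 0 u)); rewrite -bDl addr0 mulr1.
pose n := #|V|; have n_gt0 : (0 < n)%N := card_zmod_gt0 V.
(* R v is the multiplication by e_v on the twisted group algebra, acting on
   rows indexed by an enumeration of V. *)
pose R v : 'M[C]_n := \matrix_(i, j)
  (b v (enum_val i) *+ (enum_val j == v + enum_val i)).
have RM u v : R u *m R v = b u v *: R (u + v).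
  apply/matrixP => i j; rewrite !mxE.
  rewrite (bigD1 (enum_rank (u + enum_val i))) //= big1 ?addr0 => [|k kD].
    rewrite !mxE enum_rankK eqxx mulr1n addrCA addrA.
    by case: eqP => _; rewrite ?mulr0 // bDr bDl (bC v u); ring.
  rewrite !mxE; case: eqP => [ku|_]; last by rewrite mul0r.
  by rewrite -ku enum_valK eqxx in kD.
have R0 : R 0 = 1%:M.
  apply/matrixP => i j; rewrite !mxE b0 add0r (inj_eq enum_val_inj) eq_sym //.
have Rcomm : {in [seq R v | v : V] &, forall M N, comm_mx M N}.
  move=> _ _ /mapP[u _ ->] /mapP[v _ ->].
  by rewrite /comm_mx !RM bC addrC.
have [x x_neq0 /allP xR] := common_eigenvector n_gt0 Rcomm.
have mP v : exists m, x *m R v = m *: x.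
  by apply/sub_rVP/xR/map_f; rewrite mem_enum.
pose m v := projT1 (cid (mP v)); have mE v : x *m R v = m v *: x.
  by rewrite /m; case: cid.
have xI a c : a *: x = c *: x -> a = c.
  move/eqP; rewrite -subr_eq0 -scalerBl scaler_eq0 (negPf x_neq0) orbF subr_eq0.
  by move/eqP.
have m0 : m 0 = 1 by apply: xI; rewrite -mE R0 mulmx1 scale1r.
have mD u v : m u * m v = b u v * m (u + v).
  have E : x *m (R u *m R v) = (m u * m v) *: x.
    by rewrite mulmxA mE -scalemxAl mE scalerA.
  by apply: xI; rewrite -E RM -scalemxAr mE scalerA.
have m_neq0 v : m v != 0.
  apply/eqP => mv; have := mD v (- v); rewrite subrr m0 mulr1 mv mul0r.
  by move/esym/eqP; rewrite (negPf (b_neq0 _ _)).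
(* |m| is a homomorphism from a finite group to the positive numbers. *)
have m1 v : `|m v| = 1.
  apply/eqP; rewrite -(@pexpr_eq1 _ _ #|V|) ?normr_ge0 //.
  suff <- : `|m (v *+ #|V|)| = `|m v| ^+ #|V| by rewrite mulrn_card m0 normr1.
  elim: #|V| => [|k IH]; first by rewrite m0 normr1.
  by rewrite mulrS exprS -IH -normrM mD normrM b1 mul1r.
exists (fun v => (m v)^-1) => [v|u v]; first by rewrite normfV m1 invr1.
have -> : m (u + v) = m u * m v / b u v by rewrite mD; field.
by field; rewrite b_neq0 !m_neq0.
Qed.

End Trivialize.

Section Lift.
Variables (C : numClosedFieldType) (A : finZmodType).

(** The coboundary condition on lambda asks for a trivialization of
    beta(Tu, Tv) / beta(u, v), a bicharacter which is symmetric since T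
    preserves omega. *)
Lemma cl_sp_surj (T : Sp C A) : exists g : Clifford C A, cl_sp g == T.
Proof.
pose b (u v : phase C A) : C := beta (T u) (T v) / beta u v.
have bC u v : b u v = b v u.
  have := sp_omega T u v; rewrite /omega /b => E.
  have -> : beta (T u) (T v) = beta u v / beta v u * beta (T v) (T u).
    by rewrite -E; field; rewrite beta_neq0.
  by field; rewrite !beta_neq0.
have bDl u v w : b (u + v) w = b u w * b v w.
  by rewrite /b spD !betaDl; field; rewrite !beta_neq0.
have b1 u v : `|b u v| = 1 by rewrite normrM normfV !beta_norm invr1 mulr1.
have [l l1 lD] := symmetric_bicharacter_trivial bDl bC b1.
have lP : is_clifford (sp_perm T) (finfun l).
  apply: mk_cliffordP => //; first exact: spD.
  by move=> u v; rewrite lD /b; field; rewrite beta_neq0.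
by exists (@MkClifford C A (_, _) lP); apply/eqP/val_inj.
Qed.

Definition cl_lift (T : Sp C A) : Clifford C A := xchoose (cl_sp_surj T).

Lemma cl_liftK T : cl_sp (cl_lift T) = T.
Proof. exact/eqP/(xchooseP (cl_sp_surj T)). Qed.

End Lift.

(** * The inverse functor *)

Section FunctorG.
Variables (C : numClosedFieldType) (A : finZmodType).
Local Notation V := (phase C A).
Local Notation ASp := (ASp C A).
Local Notation Clifford := (Clifford C A).
Implicit Types (U W X : rep C Clifford) (v w : V) (g h : Clifford).

Lemma cl_of_char_proof (f : dual C V) :
  is_clifford (1%g : {perm V}) (finfun f).
Proof.
apply: mk_cliffordP => [u v|u|u v]; rewrite ?perm1 ?dual_norm ?dualD //.
by ring.
Qed.

Definition cl_of_char f : Clifford := @MkClifford C A (_, _) (cl_of_char_proof f).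

Lemma cl_of_charE f v : cl_fun (cl_of_char f) v = f v.
Proof. exact: ffunE. Qed.

Lemma cl_of_char_perm f v : cl_perm (cl_of_char f) v = v.
Proof. exact: perm1. Qed.

Lemma cl_of_charD f k :
  cl_of_char (f + k) = (cl_of_char f * cl_of_char k)%g.
Proof.
apply: cl_eq => v; first by rewrite cl_permM !cl_of_char_perm.
by rewrite cl_funM cl_of_char_perm !cl_of_charE dual_addE.
Qed.

Lemma cl_of_char0 : cl_of_char 0 = 1%g.
Proof.

apply: cl_eq => v; first by rewrite cl_of_char_perm.
by rewrite cl_fun1 cl_of_charE dual_zeroE.
Qed.

(** Translations form a normal subgroup, on which T acts by pullback; this is
    why (T, lambda) maps weight v to weight T v. *)
Lemma cl_of_charJ f g :
  (cl_of_char f * g = g * cl_of_char (sp_pull f (cl_sp g)))%g.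
Proof.
apply: cl_eq => v; first by rewrite !cl_permM !cl_of_char_perm.
by rewrite !cl_funM !cl_of_charE cl_of_char_perm sp_pullE mulrC.
Qed.

(** The two functions lambda have the same coboundary, so their quotient is
    a character. *)
Lemma cl_same_sp g h : cl_sp g = cl_sp h ->
  exists2 f, h = (g * cl_of_char f)%g & forall v, f v = cl_fun h v / cl_fun g v.
Proof.
move=> E; have Ep : cl_perm g =1 cl_perm h by move=> v; rewrite -!cl_spE E.
have fP : is_char (finfun (fun v => cl_fun h v / cl_fun g v)).
  apply: mk_charP => [u v|u]; last by rewrite normrM normfV !cl_norm invr1 mulr1.
  have nz := (cl_neq0 g u, cl_neq0 g v, beta_neq0 u v).
  have nzT := beta_neq0 (cl_perm h u) (cl_perm h v).
  have -> : cl_fun h (u + v) =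
      beta (cl_perm h u) (cl_perm h v) * cl_fun h u * cl_fun h v / beta u v.
    by rewrite -cl_funD; field; rewrite !nz.
  have -> : cl_fun g (u + v) =
      beta (cl_perm h u) (cl_perm h v) * cl_fun g u * cl_fun g v / beta u v.
    by rewrite -!Ep -cl_funD; field; rewrite !nz.
  by field; rewrite !nz nzT.
exists (Dual fP) => [|v]; last by rewrite ffunE.
apply: cl_eq => v; first by rewrite cl_permM cl_of_char_perm Ep.
by rewrite cl_funM cl_of_char_perm cl_of_charE ffunE mulrC divfK ?cl_neq0.
Qed.

Definition cweight W v (x : W) : Prop :=
  forall f, rep_act W (cl_of_char f) x = f v *: x.

(** The projection onto weight v, an average over translations. *)
Definition cproj W v : 'End(W) :=
  #|{: dual C V}|%:R^-1 *:
    \sum_(f : dual C V) (f v)^-1 *: rep_act W (cl_of_char f).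

Lemma cprojE W v x : cproj W v x = #|{: dual C V}|%:R^-1 *:
  \sum_(f : dual C V) (f v)^-1 *: rep_act W (cl_of_char f) x.
Proof.
rewrite scale_lfunE sum_lfunE; congr (_ *: _).
by apply: eq_bigr => f _; rewrite scale_lfunE.
Qed.

Lemma cproj_in W v x : cweight v (cproj W v x).
Proof.
move=> f; rewrite cprojE linearZ /= scalerA mulrC -scalerA.
congr (_ *: _); rewrite linear_sum scaler_sumr /=.
rewrite [RHS](reindex_inj (addrI f)) /=; apply: eq_bigr => h _.
rewrite linearZ /= cl_of_charD rep_actM comp_lfunE scalerA dual_addE invfM.
by rewrite mulVKf ?dual_neq0.
Qed.

(** Orthogonality of characters, in the form that the values at w - v of all
    characters sum to zero unless v = w. *)
Lemma cproj_weight W v w (x : W) : cweight w x ->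
  cproj W v x = if v == w then x else 0.
Proof.
move=> xw; rewrite cprojE.
transitivity (#|{: dual C V}|%:R^-1 *: (\sum_(f : dual C V) f (w - v) *: x)).
  congr (_ *: _); apply: eq_bigr => f _.
  by rewrite xw scalerA dualD dualN mulrC.
rewrite -scaler_suml sum_dual_arg subr_eq0 eq_sym.
case: eqP => _; last by rewrite scale0r scaler0.
by rewrite scalerA mulVf ?card_dual_neq0 // scale1r.
Qed.

Lemma cproj_sum W x : \sum_v cproj W v x = x.
Proof.
transitivity (\sum_v #|{: dual C V}|%:R^-1 *:
  (\sum_(f : dual C V) (f v)^-1 *: rep_act W (cl_of_char f) x)).
  by apply: eq_bigr => v _; rewrite cprojE.
rewrite -scaler_sumr exchange_big /=.
transitivity (#|{: dual C V}|%:R^-1 *: \sum_(f : dual C V)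
   (if f == 0 then #|{: V}|%:R else 0) *: rep_act W (cl_of_char f) x).
  congr (_ *: _); apply: eq_bigr => f _; rewrite -scaler_suml; congr (_ *: _).
  by rewrite -oppr_eq0 -sum_dual; apply: eq_bigr => v _; rewrite dual_oppE.
rewrite (bigD1 0) //= big1 => [|f /negPf f0]; last by rewrite f0 scale0r.
rewrite eqxx addr0 cl_of_char0 rep_act1 id_lfunE scalerA card_dual.
by rewrite mulVf ?scale1r // -(@card_dual C) card_dual_neq0.
Qed.

Lemma cweight_ext W (Y : vectType C) (f g : 'Hom(W, Y)) :
  (forall v x, cweight v x -> f x = g x) -> f = g.
Proof.
move=> fg; apply/lfunP => x; rewrite -(cproj_sum x) !linear_sum.
by apply: eq_bigr => v _ /=; apply: fg (cproj_in v x).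
Qed.

Lemma act_cweight W g v (x : W) :
  cweight v x -> cweight (cl_perm g v) (rep_act W g x).
Proof.
move=> xv f; rewrite -comp_lfunE -rep_actM cl_of_charJ rep_actM comp_lfunE xv.
by rewrite linearZ sp_pullE.
Qed.

(** Division by lambda on each weight space, for a chosen lift (T, lambda);
    [G_act_weight] shows independence of the choice. *)
Definition G_act W (g : ASp) : 'End(W) :=
  \sum_v (asp_char g v / cl_fun (cl_lift (asp_lin g)) v) *:
    (rep_act W (cl_lift (asp_lin g)) \o cproj W v)%VF.

(** Another lift is the chosen one times a translation (id, f); its lambda and
    its action on weight v both acquire the factor f(v), which cancels. *)
Lemma G_act_weight W (g : ASp) h v (x : W) :
  cl_sp h = asp_lin g -> cweight v x ->
  G_act W g x = (asp_char g v / cl_fun h v) *: rep_act W h x.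
Proof.
move=> hg xv; rewrite sum_lfunE (bigD1 v) //= big1 ?addr0 => [|w /negPf wv].
  rewrite scale_lfunE comp_lfunE (cproj_weight _ xv) eqxx.
  have [f hE fE] := cl_same_sp (etrans (cl_liftK (asp_lin g)) (esym hg)).
  rewrite [in rep_act W h]hE rep_actM comp_lfunE xv linearZ scalerA fE /=.
  by congr (_ *: _); field; rewrite !cl_neq0.
by rewrite scale_lfunE comp_lfunE (cproj_weight w xv) wv !linear0.
Qed.

Lemma G_act1 W : G_act W 1%g = \1%VF.
Proof.
apply: cweight_ext => v x xv; rewrite (@G_act_weight _ _ 1%g v) ?cl_sp1 //.
have E1 : asp_char (1%g : ASp) v = 1 by apply: dual_zeroE.
by rewrite E1 divr1 scale1r rep_act1.
Qed.

(** The product of lifts of T and S is a lift of TS, so it may be used to compute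
    the action of the product. *)
Lemma G_actM W (g k : ASp) :
  G_act W (g * k)%g = (G_act W g \o G_act W k)%VF.
Proof.
apply: cweight_ext => v x xv; rewrite comp_lfunE.
pose g' := cl_lift (asp_lin g); pose k' := cl_lift (asp_lin k).
have Eg : cl_sp g' = asp_lin g := cl_liftK _.
have Ek : cl_sp k' = asp_lin k := cl_liftK _.
have Egk : cl_sp (g' * k')%g = asp_lin (g * k)%g by rewrite cl_spM Eg Ek.
apply: etrans (G_act_weight Egk xv) _.
apply: etrans (congr1 (G_act W g) (esym (G_act_weight Ek xv))); rewrite linearZ.
apply: etrans (congr1 ( *:%R _) (esym (G_act_weight Eg (act_cweight k' xv)))).
rewrite scalerA rep_actM comp_lfunE.
congr (_ *: _); rewrite cl_funM dual_addE sp_pullE -Ek cl_spE.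
by field; rewrite !cl_neq0.
Qed.

Definition G_ob W : rep C ASp := Rep (@G_act1 W) (@G_actM W).

Lemma G_act_char W f : G_act W (asp_of_char f) = rep_act W (cl_of_char f).
Proof.
apply: cweight_ext => v x xv; rewrite (@G_act_weight _ _ 1%g v) ?cl_sp1 //.
by rewrite cl_fun1 divr1 rep_act1 id_lfunE xv.
Qed.

(** The translations of ASp(A) act on G(W) as those of C(A) act on W; the
    weight vectors are therefore the same, and the facts about weight vectors for
    ASp(A) transfer to C(A). *)
Lemma G_weightP W v (x : W) : reflect (cweight v x) (x \in weight (G_ob W) v).
Proof.
apply: (iffP (@weightP C A (G_ob W) v x)) => xv f.
  by rewrite -G_act_char; apply: (xv f).
by rewrite /= G_act_char; apply: (xv f).
Qed.

Lemma hom_cweight U W (f : rep_hom U W) v (x : U) :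
  cweight v x -> cweight v (f x).
Proof. by move=> xv k; rewrite -rep_homE xv linearZ. Qed.

Lemma G_mor_proof U W (f : rep_hom U W) (g : ASp) (x : U) :
  f (rep_act (G_ob U) g x) = rep_act (G_ob W) g (f x).
Proof.
rewrite /= -!comp_lfunE; congr (fun_of_lfun _ x).
apply: cweight_ext => v y yv; rewrite !comp_lfunE.
rewrite (G_act_weight (cl_liftK _) yv).
by rewrite (G_act_weight (cl_liftK _) (hom_cweight f yv)) linearZ /= rep_homE.
Qed.

Definition G_mor U W (f : rep_hom U W) : rep_hom (G_ob U) (G_ob W) :=
  @mk_rep_hom C ASp (G_ob U) (G_ob W) f (@G_mor_proof U W f).

Lemma tens_cweight U W v w (x : U) (y : W) :
  cweight v x -> cweight w y ->
  @cweight (rep_tens U W) (v + w) (tensv x y).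
Proof.
by move=> xv yw f; rewrite rep_tensE xv yw tensvZl tensvZr scalerA dualD.
Qed.

Lemma cweight_ext2 U W (Y : vectType C) (f g : 'Hom(tens U W, Y)) :
  (forall v w x y, cweight v x -> cweight w y ->
     f (tensv x y) = g (tensv x y)) -> f = g.
Proof.
move=> fg; apply: (@weight_ext2 _ _ (G_ob U) (G_ob W)) => v w x y.
by move=> /G_weightP xv /G_weightP yw; apply: fg xv yw.
Qed.

Lemma cweight_ext3 U W X (Y : vectType C) (f g : 'Hom(tens (tens U W) X, Y)) :
  (forall u v w x y z,
     cweight u x -> cweight v y -> cweight w z ->
     f (tensv (tensv x y) z) = g (tensv (tensv x y) z)) -> f = g.
Proof.
move=> fg; apply: (@weight_ext3 _ _ (G_ob U) (G_ob W) (G_ob X)) => u v w x y z.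
by move=> /G_weightP xu /G_weightP yv /G_weightP zw; apply: fg xu yv zw.
Qed.

Definition G_tens_map U W : 'Hom(tens U W, tens U W) :=
  twist (G_ob U) (G_ob W) (fun v w => (beta v w)^-1).

Lemma G_tens_mapE U W v w (x : U) (y : W) : cweight v x -> cweight w y ->
  G_tens_map U W (tensv x y) = (beta v w)^-1 *: tensv x y.
Proof.
by move=> /G_weightP xv /G_weightP yw; rewrite /G_tens_map (twistE _ xv yw).
Qed.

(** Equivariance is the coboundary condition relating lambda and beta, with
    both inverted. *)
Lemma G_tens_proof U W (g : ASp) x :
  G_tens_map U W (rep_act (rep_tens (G_ob U) (G_ob W)) g x) =
  rep_act (G_ob (rep_tens U W)) g (G_tens_map U W x).
Proof.
rewrite -!comp_lfunE; congr (fun_of_lfun _ x).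
apply: (@cweight_ext2 U W) => v w y z yv zw.
rewrite !comp_lfunE (G_tens_mapE yv zw) (@rep_tensE C ASp (G_ob U) (G_ob W)) /=.
have Eh := cl_liftK (asp_lin g); set h := cl_lift _ in Eh.
rewrite (G_act_weight Eh yv) (G_act_weight Eh zw) tensvZl tensvZr !linearZ /=.
rewrite (G_tens_mapE (act_cweight _ yv) (act_cweight _ zw)).
rewrite (G_act_weight Eh (tens_cweight yv zw)) rep_tensE !scalerA; congr (_ *: _).
have nz := (cl_neq0 h v, cl_neq0 h w, beta_neq0 v w,
  beta_neq0 (cl_perm h v) (cl_perm h w)).
have -> : cl_fun h (v + w) =
    beta (cl_perm h v) (cl_perm h w) * cl_fun h v * cl_fun h w / beta v w.
  by rewrite -cl_funD; field; rewrite !nz.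
by rewrite dualD; field; rewrite !nz.
Qed.

Definition G_tens U W :
    rep_hom (rep_tens (G_ob U) (G_ob W)) (G_ob (rep_tens U W)) :=
  @mk_rep_hom C ASp (rep_tens (G_ob U) (G_ob W)) (G_ob (rep_tens U W))
    (G_tens_map U W) (@G_tens_proof U W).

Lemma unit_cweight (x : rep_unit C Clifford) : @cweight (rep_unit C Clifford) 0 x.
Proof. by move=> f; rewrite /= id_lfunE dual0 scale1r. Qed.

Lemma G_unit_proof (g : ASp) (x : rep_unit C ASp) :
  (\1%VF : 'Hom(rep_unit C ASp, G_ob (rep_unit C Clifford)))
    (rep_act (rep_unit C ASp) g x) =
  rep_act (G_ob (rep_unit C Clifford)) g
   ((\1%VF : 'Hom(rep_unit C ASp, G_ob (rep_unit C Clifford))) x).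
Proof.
rewrite /= !id_lfunE (G_act_weight (cl_liftK _) (unit_cweight x)).
by rewrite cl_fun0 dual0 divr1 scale1r /= id_lfunE.
Qed.

Definition G_unit : rep_hom (rep_unit C ASp) (G_ob (rep_unit C Clifford)) :=
  @mk_rep_hom C ASp (rep_unit C ASp) (G_ob (rep_unit C Clifford)) \1%VF
    G_unit_proof.

Definition G_functor :
    tensor_functor (Rep_tensor_cat C Clifford) (Rep_tensor_cat C ASp) :=
  @TensorFunctor C (Rep_tensor_cat C Clifford) (Rep_tensor_cat C ASp)
    G_ob G_mor G_tens G_unit.

Lemma G_tens_iso U W :
  @is_iso C (Rep_tensor_cat C ASp) _ _ (G_tens U W).
Proof.
apply: (@rep_isoP C _ _ _ (G_tens U W) (twist (G_ob U) (G_ob W) beta)).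
  move=> x.
  rewrite -[RHS](@twistK _ _ (G_ob U) (G_ob W) (fun v w => (beta v w)^-1)).
    congr (fun_of_lfun _ _).
    apply: cweight_ext2 => v w y z /G_weightP yv /G_weightP zw.
    by rewrite !(twistE _ yv zw) invrK.
  by move=> v w; rewrite invr_eq0 beta_neq0.
exact: (@twistK _ _ (G_ob U) (G_ob W) beta) (@beta_neq0 C A).
Qed.

Lemma G_is_tensor_functor : is_tensor_functor G_functor.
Proof.
split.
- by move=> X; apply/val_inj.
- by move=> X Y Z f g; apply/val_inj.
- by move=> X Y a f g; apply/val_inj.
- exact: G_tens_iso.
- by apply: (@rep_isoP _ _ _ _ G_unit \1%VF) => x /=; rewrite !id_lfunE.
- move=> X X' Y Y' f g; apply/val_inj/(@cweight_ext2 X Y) => v w x y xv yw /=.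
  rewrite !comp_lfunE (G_tens_mapE xv yw) tmapE linearZ /= tmapE.
  exact: (G_tens_mapE (hom_cweight f xv) (hom_cweight g yw)).
- move=> X Y Z; apply/val_inj/(@cweight_ext3 X Y Z) => u v w x y z xu yv zw /=.
  rewrite !comp_lfunE tassocE !tmapE !id_lfunE (G_tens_mapE xu yv).
  rewrite (G_tens_mapE yv zw) tensvZr tensvZl !linearZ /=.
  rewrite (G_tens_mapE (tens_cweight xu yv) zw).
  rewrite (G_tens_mapE xu (tens_cweight yv zw)) linearZ /= tassocE !scalerA.
  by congr (_ *: _); rewrite betaDl betaDr; field; rewrite !beta_neq0.
- move=> X; apply/val_inj/(@cweight_ext2 (rep_unit C Clifford) X).
  move=> u v a x au xv /=.
  rewrite !comp_lfunE tmapE !id_lfunE (G_tens_mapE (unit_cweight a) xv).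
  by rewrite beta0l invr1 scale1r.
- move=> X; apply/val_inj/(@cweight_ext2 X (rep_unit C Clifford)).
  move=> u v x a xu av /=.
  rewrite !comp_lfunE tmapE !id_lfunE (G_tens_mapE xu (unit_cweight a)).
  by rewrite beta0r invr1 scale1r.
Qed.

(** beta(v, w)^-1 = beta(w, v)^-1 omega(w, v), so dividing by beta intertwines the
    flip with c^omega. *)
Lemma G_is_symmetric_tensor_functor :
  @is_symmetric_tensor_functor C (Rep_symmetric C Clifford)
    (Rep_omega C A) G_functor.
Proof.
split; first exact: G_is_tensor_functor.
move=> X Y; apply/val_inj/(@cweight_ext2 X Y) => v w x y xv yw /=.
rewrite !comp_lfunE (G_tens_mapE xv yw) linearZ /= tflipE.
have /G_weightP xv' := xv; have /G_weightP yw' := yw.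
rewrite (comega_mapE xv' yw') linearZ /= (G_tens_mapE yw xv).
by rewrite scalerA; congr (_ *: _); rewrite /omega; field; rewrite !beta_neq0.
Qed.

End FunctorG.

(** * Strict equality of functors, and the isomorphism *)

Section StrictIdentity.
Variables (k : fieldType) (S : tensor_cat k).

(** The composites G F and F G fix every object only up to propositional equality,
    so a morphism and its image can be compared only after transport. *)
Definition mor_cast (X X' Y Y' : S) (eX : X = X') (eY : Y = Y')
    (f : mor X Y) : mor X' Y' :=
  ecast Z (mor X' Z) eY (ecast Z (mor Z Y) eX f).

(** The hypotheses quantify over all proofs of equality of objects, so that the
    case of reflexivity is available once Fo has been replaced by the
    identity. *)
Lemma strict_id_functor (Fo : S -> S)
    (Fm : forall X Y, mor X Y -> mor (Fo X) (Fo Y))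
    (Ft : forall X Y, mor (tens_ob (Fo X) (Fo Y)) (Fo (tens_ob X Y)))
    (Fu : mor (unit_ob S) (Fo (unit_ob S))) :
  (forall X, Fo X = X) ->
  (forall X Y eX eY (f : mor X Y), mor_cast eX eY (Fm X Y f) = f) ->
  (forall X Y e e', mor_cast e e' (Ft X Y) = Defs.idm (tens_ob X Y)) ->
  (forall e, mor_cast erefl e Fu = Defs.idm (unit_ob S)) ->
  TensorFunctor Fm Ft Fu = id_functor S.
Proof.
move=> /funext E; subst Fo => Em Et Eu; rewrite /id_functor.
have -> : Fm = fun X Y => id.
  apply: functional_extensionality_dep => X.
  apply: functional_extensionality_dep => Y.
  by apply/funext => f; apply: (Em X Y erefl erefl).
have -> : Ft = fun X Y => Defs.idm (tens_ob X Y).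
  apply: functional_extensionality_dep => X.
  apply: functional_extensionality_dep => Y.
  by apply: (Et X Y erefl erefl).
by rewrite -(Eu erefl).
Qed.

End StrictIdentity.

Section StrictIdentityRep.
Variables (k : fieldType) (G : groupType).
Local Notation Rep_cat := (Rep_tensor_cat k G).
Implicit Types U W : rep k G.

Lemma rep_eq U (a : G -> 'End(U)) a1 aM :
  a =1 rep_act U -> @Rep k G U a a1 aM = U.
Proof.
case: U a a1 aM => U b b1 bM a a1 aM /= /funext E; subst a.
by congr Rep; apply: Prop_irrelevance.
Qed.

(** Transport along an equality of representations on the same space does not
    change the underlying linear map: once the actions are identified, proof
    irrelevance reduces both equalities to reflexivity. *)
Lemma rep_hom_val_cast U W (a : G -> 'End(U)) a1 aM (b : G -> 'End(W)) b1 bM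
    (eU : @Rep k G U a a1 aM = U) (eW : @Rep k G W b b1 bM = W)
    (f : rep_hom (@Rep k G U a a1 aM) (@Rep k G W b b1 bM)) :
  a =1 rep_act U -> b =1 rep_act W ->
  rep_hom_val (@mor_cast k Rep_cat _ _ _ _ eU eW f) = rep_hom_val f.
Proof.
case: U a a1 aM eU f => U a' a1' aM' a a1 aM eU f /= /funext E; subst a.
case: W b b1 bM eW f => W b' b1' bM' b b1 bM eW f /= /funext E; subst b.
move: eU eW f.
rewrite (Prop_irrelevance a1' a1) (Prop_irrelevance aM' aM).
rewrite (Prop_irrelevance b1' b1) (Prop_irrelevance bM' bM) => eU eW f.
by rewrite (Prop_irrelevance eU erefl) (Prop_irrelevance eW erefl).
Qed.

(** An endofunctor that keeps spaces and linear maps, has actions pointwise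
    equal to the given ones and has trivial structure maps is strictly the
    identity. *)
Lemma strict_id_rep_functor (a : forall U, G -> 'End(U)) a1 aM
    (Fo := fun U => @Rep k G U (a U) (a1 U) (aM U))
    (Fm : forall U W, rep_hom U W -> rep_hom (Fo U) (Fo W))
    (Ft : forall U W, rep_hom (rep_tens (Fo U) (Fo W)) (Fo (rep_tens U W)))
    (Fu : rep_hom (rep_unit k G) (Fo (rep_unit k G))) :
  (forall U, a U =1 rep_act U) ->
  (forall U W (f : rep_hom U W), rep_hom_val (Fm U W f) = rep_hom_val f) ->
  (forall U W, rep_hom_val (Ft U W) = \1%VF) ->
  rep_hom_val Fu = \1%VF ->
  @TensorFunctor k Rep_cat Rep_cat Fo Fm Ft Fu = id_functor Rep_cat.
Proof.
move=> aE FmE FtE FuE; apply: (@strict_id_functor k Rep_cat).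
- exact: (fun U => rep_eq (a1 U) (aM U) (aE U)).
- move=> U W eU eW f; apply/val_inj; apply: etrans (FmE U W f).
  exact: (@rep_hom_val_cast U W (a U) (a1 U) (aM U) (a W) (a1 W) (aM W)).
- move=> U W e e'; apply/val_inj; apply: etrans (FtE U W).
  apply: (@rep_hom_val_cast (rep_tens U W) (rep_tens U W)) => // g /=.
  by rewrite !aE.
- move=> e; apply/val_inj; apply: etrans FuE.
  by apply: (@rep_hom_val_cast (rep_unit k G) (rep_unit k G)
    (rep_act (rep_unit k G)) (rep_act1 _) (@rep_actM _ _ _)
    (a _) (a1 _) (aM _) erefl e Fu).
Qed.

End StrictIdentityRep.

Section Isomorphism.
Variables (C : numClosedFieldType) (A : finZmodType).
Local Notation ASp := (ASp C A).
Local Notation Clifford := (Clifford C A).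

(** Translations have T = id and lambda = f, so F does not change their action. *)
Lemma F_act_cweight (U : rep C ASp) v (x : U) :
  x \in weight U v -> @cweight C A (F_ob U) v x.
Proof.
move=> xv f; rewrite /= (F_act_weight _ xv) cl_of_charE.
suff -> : cl_sp (cl_of_char f) = 1%g by rewrite rho1.
by apply/val_inj/permP => u; exact: etrans (cl_of_char_perm f u) (esym (sp1E u)).
Qed.

Lemma G_F_act (U : rep C ASp) : G_act (F_ob U) =1 rep_act U.
Proof.
move=> g; apply: weight_ext => v x xv; rewrite (act_weight g xv).
rewrite (G_act_weight (cl_liftK _) (F_act_cweight xv)) /=.
by rewrite (F_act_weight _ xv) scalerA divfK ?cl_neq0 // cl_liftK.
Qed.

Lemma F_G_act (W : rep C Clifford) : F_act (G_ob W) =1 rep_act W.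
Proof.
move=> g; apply: cweight_ext => v x xv.
have xv' : x \in weight (G_ob W) v by apply/G_weightP.
rewrite (F_act_weight _ xv') /rho /= (@G_act_weight _ _ _ _ g v) //=.
by rewrite dual_zeroE scalerA mul1r mulfV ?cl_neq0 // scale1r.
Qed.

Lemma GF_id : comp_functor (G_functor C A) (F_functor C A) = id_functor _.
Proof.
apply: strict_id_rep_functor => [U|//|U W|] /=.
- exact: G_F_act.
- apply: (@weight_ext2 _ _ U W) => v w x y xv yw; rewrite comp_lfunE.
  rewrite (G_tens_mapE (F_act_cweight xv) (F_act_cweight yw)) linearZ /=.
  rewrite (F_tens_mapE xv yw) scalerA mulVf ?beta_neq0 // scale1r.
  by rewrite id_lfunE.
- by rewrite comp_lfun1l.
Qed.

Lemma FG_id : comp_functor (F_functor C A) (G_functor C A) = id_functor _.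
Proof.
apply: strict_id_rep_functor => [U|//|U W|] /=.
- exact: F_G_act.
- apply: (@cweight_ext2 _ _ U W) => v w x y xv yw; rewrite comp_lfunE.
  have [xv' yw'] : x \in weight (G_ob U) v /\ y \in weight (G_ob W) w.
    by split; apply/G_weightP.
  rewrite (F_tens_mapE xv' yw') linearZ /=.
  rewrite (G_tens_mapE xv yw) scalerA mulfV ?beta_neq0 // scale1r.
  by rewrite id_lfunE.
- by rewrite comp_lfun1l.
Qed.

End Isomorphism.

Theorem theorem3p3 (R : realType) (A : finZmodType) :
  [/\ is_symmetric_tensor_category (Rep_omega R[i] A),
      is_symmetric_tensor_category
        (Rep_symmetric R[i] (Clifford R[i] A)) &
      is_symmetric_tensor_isomorphism
        (Rep_omega R[i] A) (Rep_symmetric R[i] (Clifford R[i] A))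
        (F_functor R[i] A)].
Proof.
split.
- exact: Rep_omega_is_symmetric_tensor_category.
- exact: Rep_is_symmetric_tensor_category.
split; first exact: F_is_symmetric_tensor_functor.
exists (G_functor R[i] A); split.
- exact: G_is_symmetric_tensor_functor.
- exact: GF_id.
- exact: FG_id.
Qed.
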